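(* Fix $d\ge1$ and $c\ge1$. For every integer $k\ge1$, the intersection graph of any $n$ objects in $\mathbb{R}^d$ forming a $c$-fat collection admits a $\left(\frac{11}{9}3^k-\frac{2}{3}\right)$-hop spanner of size $O(n\,\alpha_k(n))$, where the constant in $O(\cdot)$ depends only on $d$, $k$ and $c$.
   Context: Objects are bounded subsets of $\mathbb{R}^d$. The side length of an object is the side length of its smallest enclosing axis-aligned hypercube. A collection of objects is $c$-fat if for every axis-aligned hypercube $\gamma$ with side length $\ell$, there exist $c$ points that together hit all objects of the collection that intersect $\gamma$ and have side length at least $\ell$. The intersection graph has the objects as vertices, with an edge iff the two objects intersect. For a graph $G$ and integer $t\ge1$, a $t$-hop spanner is a subgraph $\widehat{G}$ of $G$ on the same vertex set such that for every edge $uv\in E(G)$ there is a $u$–$v$ path in $\widehat{G}$ with at most $t$ edges; its size is its number of edges. The functions $\alpha_k$ form the inverse Ackermann hierarchy: $\alpha_0(n)=n/2$, and for $k\ge1$, $\alpha_k(n)$ is the number of times $\alpha_{k-1}$ must be iteratively applied starting from $n$ to reach a value at most $1$ (so $\alpha_1(n)=\Theta(\log n)$, $\alpha_2(n)=\Theta(\log^*n)$). *)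

(* Defs.v *)
From mathcomp Require Import all_boot all_order all_algebra.
From mathcomp Require Import all_classical all_reals.

Set Implicit Arguments.
Unset Strict Implicit.
Unset Printing Implicit Defensive.

Import Order.TTheory GRing.Theory Num.Theory.
Local Open Scope classical_set_scope.
Local Open Scope ring_scope.

Definition pt (R : realType) (d : nat) := 'I_d -> R.

Definition cube (R : realType) (d : nat) (a : pt R d) (l : R) : set (pt R d) :=
  [set x | forall i : 'I_d, a i <= x i <= a i + l].

Definition bounded_obj (R : realType) (d : nat) (O : set (pt R d)) : Prop :=
  exists (a : pt R d) (l : R), 0 <= l /\ O `<=` cube a l.

Definition sidelen (R : realType) (d : nat) (O : set (pt R d)) : R :=
  inf [set l : R | 0 <= l /\ exists a : pt R d, O `<=` cube a l].

Definition fat (R : realType) (d c n : nat) (O : 'I_n -> set (pt R d)) : Prop :=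
  forall (a : pt R d) (l : R), 0 < l ->
    exists P : 'I_c -> pt R d,
      forall i : 'I_n, O i `&` cube a l !=set0 -> l <= sidelen (O i) ->
        exists j : 'I_c, O i (P j).

Definition igraph_edge (T : Type) (n : nat) (O : 'I_n -> set T) (u v : 'I_n) : Prop :=
  u != v /\ O u `&` O v !=set0.

Definition is_hop_spanner (R : realType) (n : nat) (E : 'I_n -> 'I_n -> Prop)
    (H : {set {set 'I_n}}) (t : R) : Prop :=
  (forall e, e \in H -> exists u v : 'I_n, e = (finset.setU (finset.set1 u) (finset.set1 v)) /\ E u v) /\
  (forall u v : 'I_n, E u v ->
     exists p : seq 'I_n,
       path (fun x y => (finset.setU (finset.set1 x) (finset.set1 y)) \in H) u p /\ last u p = v /\ (size p)%:R <= t).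

(* Inverse Ackermann hierarchy: alpha 0 x = x/2; alpha (k+1) x = number of
   iterations of alpha k starting from x needed to reach a value <= 1. *)
Fixpoint alpha (R : realType) (k : nat) : R -> R :=
  match k with
  | 0 => fun x => x / 2
  | k'.+1 => fun x =>
      inf [set (m%:R : R) | m in [set m : nat | iter m (alpha k') x <= 1]]
  end.

(* Main.v *)
Require Import Defs.
From mathcomp Require Import all_boot all_order all_algebra.
From mathcomp Require Import all_classical all_reals.
From mathcomp Require Import zify ring lra.

Set Implicit Arguments.
Unset Strict Implicit.
Unset Printing Implicit Defensive.
Import Order.TTheory GRing.Theory Num.Theory.

(**
2d+1 shifted quadtrees are used, the cells of level l of the s-th one having side
e b^l and corners in e b^l (Z + s/D), with D = 2d+1 and b = D+1 (so that the grids
are nested).  An object spoils at most one shift per coordinate at its own scale,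
so any two objects are both contained in cells of comparable size of one common
quadtree.  There, the smaller of two intersecting objects lies in the subtree of
the cell of the larger one, and fatness covers all the large objects that
reach into a cell by boundedly many cliques of objects through a common point.

For such a tree with n vertices, cut it into pieces of size a = alpha_k(n), each
piece having at most one piece hanging below it; this takes O(n/a) cuts.  If u lies
in a piece with top B and its neighbour v lies above B, then u is joined to one
representative r in the clique (at B) containing v.  Grouping the vertices of each
piece by the cliques covering its hole turns the tree into one with O(n/a) groups,
and r and v are in adjacent groups.  A spanner of the groups at level k of the
hierarchy, which joins some members ("ports") of adjacent groups, together with a
star for each group, adds 5 hops and O(n) edges; the pieces are treated
recursively, alpha_{k+1}(n) times in all.  For k = 1, halving and joining r and v
through the head of their common clique gives 3 hops.  The resulting bound of
5k - 2 hops is at most (11/9) 3^k - 2/3.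
*)

(** * Trees, and their division into pieces with one hole *)

Inductive tree (L : Type) :=
  | Leaf
  | One (x : L) (t : tree L)
  | Two (t1 t2 : tree L).
Arguments Leaf {L}.

Inductive context (L : Type) :=
  | Hole
  | COne (x : L) (K : context L)
  | CLeft (K : context L) (t : tree L)
  | CRight (t : tree L) (K : context L).
Arguments Hole {L}.

(** [DHole K d] cuts off the piece [K] and continues in its hole; [DTwo] is a branching that belongs
    to no piece. Only one hole per piece is possible, so what leaves a piece downwards does so along
    a single path. *)
Inductive division (L : Type) :=
  | DEnd (t : tree L)
  | DHole (K : context L) (d : division L)
  | DTwo (d1 d2 : division L).

Section Trees.
Variable L : eqType.
Implicit Types (t : tree L) (K : context L) (d : division L) (s : seq L).

Fixpoint labels t : seq L :=
  match t with
  | Leaf => [::]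
  | One x t => x :: labels t
  | Two t1 t2 => labels t1 ++ labels t2
  end.

Fixpoint plug K t :=
  match K with
  | Hole => t
  | COne x K => One x (plug K t)
  | CLeft K t2 => Two (plug K t) t2
  | CRight t1 K => Two t1 (plug K t)
  end.

Fixpoint spine K : seq L :=
  match K with
  | Hole => [::]
  | COne x K => x :: spine K
  | CLeft K _ => spine K
  | CRight _ K => spine K
  end.

Definition clabels K := labels (plug K Leaf).

Fixpoint flat d : tree L :=
  match d with
  | DEnd t => t
  | DHole K d => plug K (flat d)
  | DTwo d1 d2 => Two (flat d1) (flat d2)
  end.

(** Each piece comes with its context, the labels on the path from the root down to its top.
    Off-path labels of a piece are dropped when passing through its hole. *)
Fixpoint pieces d s : seq (seq L * tree L) :=
  match d with
  | DEnd t => [:: (s, t)]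
  | DHole K d => (s, plug K Leaf) :: pieces d (spine K ++ s)
  | DTwo d1 d2 => pieces d1 s ++ pieces d2 s
  end.

Lemma labels_plug K t : perm_eq (labels (plug K t)) (clabels K ++ labels t).
Proof.
rewrite /clabels; elim: K => //= [x K IH|K IH t2|t1 K IH].
- by rewrite perm_cons.
- apply: (@perm_trans _ ((labels (plug K Leaf) ++ labels t) ++ labels t2)).
    by rewrite perm_cat2r.
  by rewrite -!catA perm_cat2l perm_catC.
- by rewrite -catA perm_cat2l.
Qed.

Lemma mem_plug K t g : (g \in labels (plug K t)) = (g \in clabels K) || (g \in labels t).
Proof. by rewrite (perm_mem (labels_plug K t)) mem_cat. Qed.

Lemma size_plug K t : size (labels (plug K t)) = size (clabels K) + size (labels t).
Proof. by rewrite (perm_size (labels_plug K t)) size_cat. Qed.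

Lemma spine_sub K : {subset spine K <= clabels K}.
Proof.
rewrite /clabels; elim: K => //= [x K IH|K IH t2|t1 K IH] y.
- by rewrite !inE => /orP[->//|/IH->]; rewrite orbT.
- by rewrite mem_cat => /IH ->.
- by rewrite mem_cat => /IH ->; rewrite orbT.
Qed.

Lemma size_spine K : size (spine K) <= size (clabels K).
Proof. by rewrite /clabels; elim: K => //= *; rewrite ?size_cat; lia. Qed.

Lemma sumn_pieces d s :
  sumn [seq size (labels p.2) | p <- pieces d s] = size (labels (flat d)).
Proof.
elim: d s => //= [t s|K d IH s|d1 IH1 d2 IH2 s]; first by rewrite addn0.
- by rewrite IH [RHS]size_plug.
- by rewrite map_cat sumn_cat IH1 IH2 size_cat.
Qed.

Lemma pieces_ctx d s p : List.In p (pieces d s) -> {subset s <= p.1}.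
Proof.
elim: d s => [t s|K d IH s|d1 IH1 d2 IH2 s] /=.
- by case=> [<-|].
- case=> [<-//|/IH sub] x xs; apply: sub; by rewrite mem_cat xs orbT.
- by move=> /List.in_app_iff[/IH1|/IH2].
Qed.

Lemma size_pieces_ctx d s p :
  List.In p (pieces d s) -> size p.1 <= size s + size (labels (flat d)).
Proof.
elim: d s => [t s|K d IH s|d1 IH1 d2 IH2 s] /=.
- by case=> [<-|//]; rewrite leq_addr.
- case=> [<-|/IH]; first by rewrite leq_addr.
  by rewrite size_cat size_plug; have := size_spine K; lia.
- by move=> /List.in_app_iff[/IH1|/IH2]; rewrite size_cat; lia.
Qed.

Lemma mem_pieces d s g : g \in labels (flat d) ->
  exists2 p, List.In p (pieces d s) & g \in labels p.2.
Proof.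
elim: d s => [t s|K d IH s|d1 IH1 d2 IH2 s] /= gd.
- by exists (s, t); [left|].
- move: gd; rewrite mem_plug => /orP[gK|/IH-/(_ (spine K ++ s))[p pd gp]].
    by exists (s, plug K Leaf); [left|].
  by exists p; [right|].
- move: gd; rewrite mem_cat => /orP[/IH1|/IH2] /(_ s)[p pd gp];
    by exists p => //; apply/List.in_app_iff; tauto.
Qed.

Lemma pieces_sub d s p :
  List.In p (pieces d s) -> {subset labels p.2 <= labels (flat d)}.
Proof.
elim: d s => [t s|K d IH s|d1 IH1 d2 IH2 s] /=.
- by case=> [<-|].
- case=> [<-|/IH sub] x xs; rewrite mem_plug; first by rewrite [_ \in _]xs.
  by rewrite (sub _ xs) orbT.
- by move=> /List.in_app_iff[/IH1 sub|/IH2 sub] x xs; rewrite mem_cat (sub _ xs) ?orbT.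
Qed.

(** Bottom-up greedy cutting: an open part grows until it has at least [a./2.+1] labels, then it is
    closed. Two open parts below this threshold still fit together into one piece of size [a]. *)
Lemma division_exists (a : nat) t : 0 < a <= size (labels t) ->
  exists d, [/\ flat d = t,
    forall p, List.In p (pieces d [::]) -> size (labels p.2) <= a &
    size (pieces d [::]) * (a./2).+1 <= 3 * size (labels t)].
Proof.
case/andP=> a0 an; set mu := (a./2).+1.
have mua : mu <= a by rewrite /mu; lia.
have mu2 : mu.*2 <= a.+2 by rewrite /mu; lia.
have mu0 : 0 < mu by [].
clearbody mu.
pose small d := forall s p, List.In p (pieces d s) -> size (labels p.2) <= a.
have szE d s s' : size (pieces d s) = size (pieces d s').
  by elim: d s s' => //= [K d IH s s'|d1 IH1 d2 IH2 s s'];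
    [congr S|rewrite !size_cat; congr addn].
(* The number [e] is a credit of pieces already paid for but not yet made. *)
pose few d e := (size (pieces d [::]) + e) * mu <= 3 * size (labels (flat d)).
have fewE t' : size (labels t') >= mu -> size (labels t') <= a ->
    small (DEnd t') /\ few (DEnd t') 2.
  move=> h1 h2; split; first by move=> s p /= [<-|].
  by rewrite /few /=; lia.
have fewH K d : size (clabels K) >= mu -> size (clabels K) <= a -> small d -> few d 2 ->
    small (DHole K d) /\ few (DHole K d) 2.
  move=> h1 h2 sd fd; split; first by move=> s p /= [<-|/sd].
  move: fd; rewrite /few /= size_plug (szE _ _ [::]); lia.
have [tmu|[K [d [tE Kmu sd fd]]]] : size (labels t) < mu \/ (exists K d,
    [/\ t = plug K (flat d), size (clabels K) < mu, small d & few d 2]); [|by lia|].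
  elim: t {an} => [|x t IH|t1 IH1 t2 IH2] /=; first by left.
  - case: IH => [tmu|[K [d [tE Kmu sd fd]]]].
      have [h|h] := ltnP (size (labels t)).+1 mu; first by left.
      have [] := fewE (One x t); [done|by rewrite /=; lia|move=> sd fd].
      by right; exists Hole, (DEnd (One x t)).
    right; have [h|h] := ltnP (size (clabels (COne x K))) mu.
      by exists (COne x K), d; split; rewrite //= tE.
    have [] := fewH (COne x K) d h _ sd fd; first by move: Kmu; rewrite /clabels /=; lia.
    by move=> sd' fd'; exists Hole, (DHole (COne x K) d); split=> //=; rewrite tE.
  - case: IH1 => [tmu1|[K1 [d1 [tE1 Kmu1 sd1 fd1]]]];
    case: IH2 => [tmu2|[K2 [d2 [tE2 Kmu2 sd2 fd2]]]].
    + rewrite size_cat; have [h|h] := ltnP (size (labels t1) + size (labels t2)) mu; first by left.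
      have [] := fewE (Two t1 t2); rewrite /= ?size_cat //; first by lia.
      by move=> sd fd; right; exists Hole, (DEnd (Two t1 t2)).
    + right; have [h|h] := ltnP (size (clabels (CRight t1 K2))) mu.
        by exists (CRight t1 K2), d2; split; rewrite //= tE2.
      have [] := fewH (CRight t1 K2) d2 h _ sd2 fd2.
        by move: Kmu2; rewrite /clabels /= size_cat; lia.
      by move=> sd' fd'; exists Hole, (DHole (CRight t1 K2) d2); split=> //=; rewrite tE2.
    + right; have [h|h] := ltnP (size (clabels (CLeft K1 t2))) mu.
        by exists (CLeft K1 t2), d1; split; rewrite //= tE1.
      have [] := fewH (CLeft K1 t2) d1 h _ sd1 fd1.
        by move: Kmu1; rewrite /clabels /= size_cat; lia.
      by move=> sd' fd'; exists Hole, (DHole (CLeft K1 t2) d1); split=> //=; rewrite tE1.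
    (* Two open contexts cannot merge into a piece with one hole, so both are closed. Of the joint
       credit 4, these two pieces use 2, and the invariant keeps 2. *)
    + right; exists Hole, (DTwo (DHole K1 d1) (DHole K2 d2)); split=> //=.
      * by rewrite tE1 tE2.
      * move=> s p /= [<-/=|/List.in_app_iff[/sd1//|/= [<-/=|/sd2//]]];
          by [rewrite -/(clabels K1); lia|rewrite -/(clabels K2); lia].
      * move: fd1 fd2; rewrite /few /= !size_cat /= (size_plug K1) (size_plug K2).
        rewrite (szE d1 _ [::]) (szE d2 _ [::]).
        move: (size (pieces d1 _)) (size (pieces d2 _)) => N1 N2 f1 f2.
        have -> : N1.+1 + N2.+1 + 2 = (N1 + 2) + (N2 + 2) by lia.
        rewrite mulnDl; apply: leq_trans (leq_add f1 f2) _; rewrite -mulnDr; lia.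
exists (DHole K d); split=> //.
  move=> p /= [<-/=|]; last exact: sd.
    by rewrite -/(clabels K); lia.
  rewrite tE; move: fd; rewrite /few /= size_plug (szE _ _ [::]); lia.
Qed.

End Trees.

(** * Graphs covered by cliques along a tree *)

Section Nets.
Variables (V : eqType) (adj : rel V).
Hypothesis adjC : symmetric adj.
Implicit Types (u v w : V) (g h q : seq V) (s : seq (seq V)) (t : tree (seq V)).

Definition linked g h := has (fun u => has (adj u) h) g.

Lemma linkedP g h :
  reflect (exists u v, [/\ u \in g, v \in h & adj u v]) (linked g h).
Proof.
apply: (iffP hasP) => [[u ug /hasP[v vh uv]]|[u [v [ug vh uv]]]].
  by exists u, v.
by exists u => //; apply/hasP; exists v.
Qed.

Lemma linkedC g h : linked g h = linked h g.
Proof.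
by apply/linkedP/linkedP => -[u [v [ug vh uv]]]; exists v, u; split; rewrite // adjC.
Qed.

(** The case [u = v] is included: the loops at members are edges, so joining a member to the head of
    the clique is valid even if it is the head. *)
Definition clique q := all (fun u => all (adj u) q) q.

Lemma cliqueP q : reflect {in q &, forall u v, adj u v} (clique q).
Proof.
apply: (iffP allP) => [H u v uq vq|H u uq]; first exact: (allP (H u uq)).
by apply/allP => v; apply: H.
Qed.

(** The combinatorial trace of fatness: [s1] lies above a cell, [s2] inside it, and [Q] consists of
    the cliques through the piercing points. Only vertices of [s1] with a neighbour in [s2] have to
    be covered. *)
Definition covers (c : nat) s1 s2 := exists Q : seq (seq V),
  [/\ size Q <= c, all clique Q &
      forall g h u v, g \in s2 -> h \in s1 -> u \in g -> v \in h -> adj u v ->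
        exists2 q, q \in Q & v \in q].

(** Here [s] collects the labels above [t]. Since branches are unlinked, linked labels always lie on
    a common path from the root. *)
Fixpoint good c s t : Prop :=
  covers c s (labels t) /\
  match t with
  | Leaf => True
  | One x t => good c (x :: s) t
  | Two t1 t2 => [/\ good c s t1, good c s t2 &
      forall g h, g \in labels t1 -> h \in labels t2 -> ~~ linked g h]
  end.

Lemma goodE c s t : good c s t -> covers c s (labels t).
Proof. by case: t => [|x t|t1 t2] []. Qed.

Lemma covers_sub c c' s1 s2 s1' s2' : c <= c' ->
  {subset s1' <= s1} -> {subset s2' <= s2} -> covers c s1 s2 -> covers c' s1' s2'.
Proof.
move=> cc sub1 sub2 [Q [szQ clQ HQ]]; exists Q; split=> //; first exact: leq_trans cc.
by move=> g h u v /sub2 g2 /sub1 h1; apply: HQ g2 h1.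
Qed.

Lemma good_sub c c' s s' t : c <= c' -> {subset s' <= s} -> good c s t -> good c' s' t.
Proof.
move=> cc; elim: t s s' => [|x t IH|t1 IH1 t2 IH2] s s' sub /= [cov gt]; split;
  try exact: covers_sub cov.
- exact: gt.
- by apply: IH gt => y; rewrite !inE => /orP[->//|/sub->]; rewrite orbT.
- by case: gt => g1 g2 g12; split=> //; [apply: IH1 g1|apply: IH2 g2].
Qed.

Lemma good_plug_leaf c s K t : good c s (plug K t) -> good c s (plug K Leaf).
Proof.
have cov K' s' : covers c s' (labels (plug K' t)) -> covers c s' (labels (plug K' Leaf)).
  by apply: covers_sub => // g gK; rewrite mem_plug [_ \in _]gK.
have sub K' : {subset labels (plug K' Leaf) <= labels (plug K' t)}.
  by move=> g gK; rewrite mem_plug [_ \in _]gK.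
elim: K s => /= [|x K IH|K IH t2|t1 K IH] s.
- move=> /goodE cv; split=> //; exact: covers_sub cv.
- by move=> [cv gK]; split; [exact: (cov (COne x K))|exact: IH].
- move=> [cv [g1 g2 g12]]; split; first exact: (cov (CLeft K t2)).
  by split; [exact: IH| |move=> g h /sub; apply: g12].
- move=> [cv [g1 g2 g12]]; split; first exact: (cov (CRight t1 K)).
  by split; [|exact: IH|move=> g h g1' /sub; apply: g12].
Qed.

Lemma good_plug c s K t : good c s (plug K t) -> good c (spine K ++ s) t.
Proof.
elim: K s => /= [|x K IH|K IH t2|t1 K IH] s //.
- move=> [_ /IH]; apply: good_sub => // y.
  by rewrite !(inE, mem_cat) => /or3P[] ->; rewrite ?orbT.
- by move=> [_ [/IH]].
- by move=> [_ [_ /IH]].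
Qed.

(** A label of [K] off the spine is separated from the hole by some branching, whose sides are
    unlinked. *)
Lemma linked_plug c s K t g h : good c s (plug K t) ->
  g \in labels t -> h \in clabels K -> linked g h -> h \in spine K.
Proof.
rewrite /clabels; elim: K s => /= [|x K IH|K IH t2|t1 K IH] s //.
- by move=> [_ /IH H] gt; rewrite !inE => /orP[->//|hK /(H gt hK)->]; rewrite orbT.
- move=> [_ [/IH H _ no]] gt; rewrite mem_cat => /orP[hK /(H gt hK)//|h2].
  by move=> gh; have := no g h; rewrite mem_plug gt orbT h2 gh => /(_ isT isT).
- move=> [_ [_ /IH H no]] gt; rewrite mem_cat => /orP[h1|hK /(H gt hK)//].
  by rewrite linkedC => gh; have := no h g; rewrite mem_plug gt orbT h1 gh => /(_ isT isT).
Qed.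

Lemma good_pieces c d s p : good c s (flat d) -> List.In p (pieces d s) -> good c p.1 p.2.
Proof.
elim: d s => [t|K d IH|d1 IH1 d2 IH2] s /=.
- by move=> gt [<-|].
- move=> gd [<-|]; first exact: good_plug_leaf gd.
  exact: IH (good_plug gd).
- by move=> [_ [g1 g2 _]] /List.in_app_iff[/IH1|/IH2]; apply.
Qed.

(** This reduces the task to two kinds of links: inside a piece, left to the recursion, and from a
    piece to its context, served by the cliques covering that context. *)
Lemma linked_pieces c d s g h : good c s (flat d) ->
  g \in labels (flat d) -> h \in labels (flat d) -> linked g h ->
  exists2 p, List.In p (pieces d s) &
    [\/ (g \in labels p.2) /\ (h \in labels p.2),
        (g \in labels p.2) /\ (h \in p.1) | (h \in labels p.2) /\ (g \in p.1)].
Proof.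
elim: d s => [t|K d IH|d1 IH1 d2 IH2] s /= gd.
- by move=> gt ht _; exists (s, t); [left|constructor 1].
- have cross a b : a \in labels (flat d) -> b \in clabels K -> linked a b ->
      exists2 p, List.In p (pieces d (spine K ++ s)) & (a \in labels p.2) /\ (b \in p.1).
    move=> ad bK ab; have [p pd ap] := mem_pieces (spine K ++ s) ad.
    exists p => //; split=> //; apply: pieces_ctx pd _ _.
    by rewrite mem_cat (linked_plug gd ad bK ab).
  rewrite (mem_plug K (flat d) g) (mem_plug K (flat d) h) => /orP[gK|gt] /orP[hK|ht] gh.
  + by exists (s, plug K Leaf); [left|constructor 1].
  + have [|p pd [? ?]] := cross _ _ ht gK; first by rewrite linkedC.
    by exists p; [right|constructor 3].
  + have [p pd [? ?]] := cross _ _ gt hK gh.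
    by exists p; [right|constructor 2].
  + have [p pd H] := IH _ (good_plug gd) gt ht gh.
    by exists p; [right|].
- case: gd => _ [gd1 gd2 no].
  rewrite !mem_cat => /orP[g1|g2] /orP[h1|h2] gh.
  + have [p pd H] := IH1 _ gd1 g1 h1 gh; exists p => //; apply/List.in_app_iff; tauto.
  + by have := no _ _ g1 h2; rewrite gh.
  + by have := no _ _ h1 g2; rewrite linkedC gh.
  + have [p pd H] := IH2 _ gd2 g2 h2 gh; exists p => //; apply/List.in_app_iff; tauto.
Qed.

(** Undirected walks that may rest, so [n] acts as an upper bound on the length. *)
Fixpoint conn (H : seq (V * V)) n u v : Prop :=
  if n is n'.+1 then
    exists2 w, [|| u == w, (u, w) \in H | (w, u) \in H] & conn H n' w v
  else u = v.

Lemma conn_sub H H' n u v : {subset H <= H'} -> conn H n u v -> conn H' n u v.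
Proof.
move=> sub; elim: n u => //= n IH u [w uw /IH]; exists w => //.
by case/or3P: uw => [->//|/sub->|/sub->]; rewrite ?orbT.
Qed.

Lemma conn_trans H m n u v w : conn H m u v -> conn H n v w -> conn H (m + n) u w.
Proof.
elim: m u => [u <-//|m IH u] /= [x ux xv] vw; exists x => //; exact: IH.
Qed.

Lemma conn1 H u v : (u, v) \in H -> conn H 1 u v.
Proof. by move=> uv; exists v; rewrite ?uv ?orbT. Qed.

Lemma conn1C H u v : (v, u) \in H -> conn H 1 u v.
Proof. by move=> uv; exists v; rewrite ?uv ?orbT. Qed.

Lemma conn_refl H n u : conn H n u u.
Proof. by elim: n => //= n IH; exists u; rewrite ?eqxx. Qed.

Lemma conn_le H m n u v : m <= n -> conn H m u v -> conn H n u v.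
Proof. by move=> /subnKC <- /conn_trans; apply; apply: conn_refl. Qed.

Lemma connC H n u v : conn H n u v -> conn H n v u.
Proof.
elim: n u => //= n IH u [w uw /IH wv].
have wu : conn H 1 w u.
  by exists u => //; case/or3P: uw => [/eqP->|->|->]; rewrite ?eqxx ?orbT.
by have := conn_trans wv wu; rewrite addn1.
Qed.

(* The second component of a net records the ports: for each label, the
   vertices of the label at which spanner paths may enter or leave it. *)
Definition net : Type := seq (V * V) * seq (seq V * V).

(** Ports are counted too, because one level up each port of the quotient costs a star edge. *)
Definition cost (X : net) := size X.1 + size X.2.

Definition valid (X : net) :=
  all (fun e => adj e.1 e.2) X.1 && all (fun e => e.2 \in e.1) X.2.

Definition subnet (X Y : net) := {subset X.1 <= Y.1} /\ {subset X.2 <= Y.2}.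

Definition joined f (X : net) g h := exists u v,
  [/\ (g, u) \in X.2, (h, v) \in X.2 & conn X.1 f u v].

Definition solved f (X : net) t := forall g h, g \in labels t -> h \in labels t ->
  g != h -> linked g h -> joined f X g h.

Definition netcat (X Y : net) : net := (X.1 ++ Y.1, X.2 ++ Y.2).

Lemma cost_cat X Y : cost (netcat X Y) = cost X + cost Y.
Proof. by rewrite /cost !size_cat; lia. Qed.

Lemma valid_cat X Y : valid (netcat X Y) = valid X && valid Y.
Proof. by rewrite /valid !all_cat; case: all; case: all; case: all. Qed.

Lemma subnet_catl X Y : subnet X (netcat X Y).
Proof. by split=> x; rewrite mem_cat => ->. Qed.

Lemma subnet_catr X Y : subnet Y (netcat X Y).
Proof. by split=> x; rewrite mem_cat orbC => ->. Qed.

Lemma subnet_trans X Y Z : subnet X Y -> subnet Y Z -> subnet X Z.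
Proof. by move=> [s1 s2] [s3 s4]; split=> x; [move/s1/s3|move/s2/s4]. Qed.

Lemma joined_sub f X Y g h : subnet X Y -> joined f X g h -> joined f Y g h.
Proof.
move=> [s1 s2] [u [v [gu hv uv]]]; exists u, v.
by split; [exact: s2|exact: s2|exact: conn_sub uv].
Qed.

Lemma joined_le f f' X g h : f <= f' -> joined f X g h -> joined f' X g h.
Proof. by move=> ff [u [v [gu hv /(conn_le ff) uv]]]; exists u, v. Qed.

Lemma joinedC f X g h : joined f X g h -> joined f X h g.
Proof. by move=> [u [v [gu hv /connC uv]]]; exists v, u. Qed.

Lemma gather (I : Type) (W : seq I) (e : I -> nat) (S : I -> net -> Prop) :
  (forall i X Y, subnet X Y -> S i X -> S i Y) ->
  (forall i, List.In i W -> exists X, [/\ valid X, cost X <= e i & S i X]) ->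
  exists X, [/\ valid X, cost X <= sumn (map e W) & forall i, List.In i W -> S i X].
Proof.
move=> mono; elim: W => [|i W IH] HW; first by exists ([::], [::]).
have [|X [vX cX SX]] := IH; first by move=> j jW; apply: HW; right.
have [|Y [vY cY SY]] := HW i; first by left.
exists (netcat Y X); split; first by rewrite valid_cat vX vY.
  by rewrite cost_cat /=; lia.
move=> j [<-|/SX SjX]; first exact: mono (subnet_catl Y X) SY.
exact: mono (subnet_catr Y X) SjX.
Qed.

Lemma gather_seq (I : eqType) (W : seq I) (e : nat) (S : I -> net -> Prop) :
  (forall i X Y, subnet X Y -> S i X -> S i Y) ->
  (forall i, i \in W -> exists X, [/\ valid X, cost X <= e & S i X]) ->
  exists X, [/\ valid X, cost X <= e * size W & forall i, i \in W -> S i X].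
Proof.
move=> mono HW; have inP i : i \in W -> List.In i W.
  by elim: (W) => //= j W' IH; rewrite inE => /orP[/eqP->|/IH]; [left|right].
have inP' i : List.In i W -> i \in W.
  by elim: (W) => //= j W' IH [->|/IH]; rewrite inE ?eqxx // => ->; rewrite orbT.
have [|X [vX cX SX]] := @gather I W (fun=> e) S mono; first by move=> i /inP'/HW.
exists X; split=> //; last by move=> i /inP/SX.
by apply: leq_trans cX _; rewrite mulnC; elim: (W) => //= _ W'; rewrite mulSn; lia.
Qed.

(** Heads serve as star centres; on a nonempty clique the default given to [head] is immaterial. *)
Lemma head_mem q u v : u \in q -> v \in q -> head u q = head v q.
Proof. by case: q. Qed.

Lemma head_in q u : u \in q -> head u q \in q.
Proof. by case: q => //= v q _; rewrite mem_head. Qed.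

End Nets.

(** * The recursion on the levels of the hierarchy *)

Section Levels.
Variables (V : eqType) (adj : rel V).
Hypothesis adjC : symmetric adj.
Implicit Types (u v w : V) (g h q : seq V) (s : seq (seq V)) (t : tree (seq V)).

Local Notation linked := (linked adj).
Local Notation covers := (covers adj).
Local Notation good := (good adj).
Local Notation clique := (clique adj).
Local Notation valid := (valid adj).

Definition splits c f A (small : nat -> nat -> Prop) := forall t,
  good c [::] t -> 1 < size (labels t) ->
  exists ts X, [/\ forall p, List.In p ts ->
        good c [::] p /\ small (size (labels p)) (size (labels t)),
      sumn [seq size (labels p) | p <- ts] <= size (labels t),
      valid X, cost X <= A * size (labels t) &
      forall g h, g \in labels t -> h \in labels t -> g != h -> linked g h ->
        (exists2 p, List.In p ts & g \in labels p /\ h \in labels p) \/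
        joined f X g h].

(** Each round of splitting costs at most [A] per label in total, and replaces every size by at most
    its image under [al]; after [j] rounds no tree has two labels. *)
Lemma unroll (R : numDomainType) (al : R -> R) c f A :
  {homo al : x y / (x <= y)%R} ->
  splits c f A (fun m n => m%:R <= al n%:R)%R ->
  forall j t, good c [::] t -> (iter j al (size (labels t))%:R <= 1)%R ->
  exists X, [/\ valid X, cost X <= A * size (labels t) * j & solved adj f X t].
Proof.
move=> al_mono step j; elim: j => [|j IH] t gt; have [n1|n1] := leqP (size (labels t)) 1.
- exists ([::], [::]); split=> // g h; move: n1.
  by case: (labels t) => [|x [|]] //= _; rewrite !inE => /eqP-> /eqP->; rewrite eqxx.
- by rewrite /= lern1 leqNgt n1.
- exists ([::], [::]); split=> // g h; move: n1.
  by case: (labels t) => [|x [|]] //= _; rewrite !inE => /eqP-> /eqP->; rewrite eqxx.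
rewrite iterSr => itj; have [ts [X [Hts szts vX cX HX]]] := step t gt n1.
have [||Y [vY cY HY]] := @gather _ adj _ ts (fun p => A * size (labels p) * j)
    (fun p Y => solved adj f Y p).
- by move=> p Y Z YZ sol g h gp hp gh lgh; apply: joined_sub YZ (sol _ _ gp hp gh lgh).
- move=> p /Hts [gp small]; apply: IH => //; apply: le_trans itj.
  by elim: (j) => //= i IHi; apply: al_mono.
exists (netcat X Y); split; first by rewrite valid_cat vX vY.
- rewrite cost_cat mulnS; apply: leq_add => //; apply: leq_trans cY _.
  apply: (@leq_trans (A * j * sumn [seq size (labels p) | p <- ts])); last first.
    by rewrite [leqRHS]mulnAC leq_mul2l szts orbT.
  elim: (ts) => //= p ts' IHs; rewrite mulnDr leq_add //.
  by rewrite mulnAC.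
- move=> g h gt' ht' gh lgh; have [[p pts [gp hp]]|J] := HX _ _ gt' ht' gh lgh.
    apply: joined_sub (HY p pts _ _ gp hp gh lgh); exact: subnet_catr.
  apply: joined_sub J; exact: subnet_catl.
Qed.

(** The walk is u' - r - z - v' with z the head of a clique [q]. For each pair of a lower label and
    a clique one edge u'r and the edge rz are bought; for each pair of a clique and an upper label,
    one edge zv'. *)
Lemma piece_one c s1 s2 : covers c s1 s2 ->
  exists X, [/\ valid X, cost X <= 3 * c * size s2 + 2 * c * size s1 &
    forall g h, g \in s2 -> h \in s1 -> linked g h -> joined 3 X g h].
Proof.
move=> [Q [szQ /allP clQ HQ]].
have clQ' q u v : q \in Q -> u \in q -> v \in q -> adj u v.
  by move=> /clQ/cliqueP; apply.
have [||X [vX cX SX]] := @gather_seq _ adj _ [seq (g, q) | g <- s2, q <- Q] 3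
  (fun gq X => (exists u r, [/\ u \in gq.1, r \in gq.2 & adj u r]) ->
     exists u r, [/\ (gq.1, u) \in X.2, r \in gq.2, (u, r) \in X.1 &
       (r, head r gq.2) \in X.1]).
- move=> [g q] X Y [sub1 sub2] SX /SX[u [r [gu rq ur rz]]].
  by exists u, r; split; rewrite ?sub1 ?sub2.
- move=> [g q] /allpairsP[[g' q'] [/= gs qQ [-> ->]]].
  case: (pselect (exists u r, [/\ u \in g', r \in q' & adj u r])); last first.
    by exists ([::], [::]).
  move=> [u [r [ug rq ur]]]; exists ([:: (u, r); (r, head r q')], [:: (g', u)]).
  split=> //; first by rewrite /valid /= ur ug (clQ' q') ?head_in.
  by move=> _; exists u, r; split; rewrite ?inE ?eqxx ?orbT.
have [||Y [vY cY SY]] := @gather_seq _ adj _ [seq (q, h) | q <- Q, h <- s1] 2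
  (fun qh Y => (exists v, v \in qh.1 /\ v \in qh.2) ->
     exists v, [/\ v \in qh.1, (qh.2, v) \in Y.2 & (head v qh.1, v) \in Y.1]).
- move=> [q h] X' Y [sub1 sub2] SY /SY[v [vq hv zv]].
  by exists v; split; rewrite ?sub1 ?sub2.
- move=> [q h] /allpairsP[[q' h'] [/= qQ hs [-> ->]]].
  case: (pselect (exists v, v \in q' /\ v \in h')); last by exists ([::], [::]).
  move=> [v [vq vh]]; exists ([:: (head v q', v)], [:: (h', v)]).
  split=> //; first by rewrite /valid /= vh (clQ' q') ?head_in.
  by move=> _; exists v; split; rewrite ?inE ?eqxx ?orbT.
exists (netcat X Y); split; first by rewrite valid_cat vX vY.
  rewrite cost_cat; apply: leq_add.
    by apply: leq_trans cX _; rewrite size_allpairs -mulnA leq_mul2l /= mulnC leq_mul2r szQ orbT.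
  by apply: leq_trans cY _; rewrite size_allpairs -mulnA leq_mul2l /= leq_mul2r szQ orbT.
move=> g h gs hs /linkedP[u [v [ug vh uv]]].
have [q qQ vq] := HQ _ _ _ _ gs hs ug vh uv.
have [|u' [r [gu' rq ur rz]]] := SX (g, q) (allpairs_f _ gs qQ); first by exists u, v.
have [|v' [v'q hv' zv']] := SY (q, h) (allpairs_f _ qQ hs); first by exists v.
have [subX subY] := (subnet_catl X Y, subnet_catr X Y).
exists u', v'; split; [exact: subX.2|exact: subY.2|].
rewrite (_ : 3 = 1 + (1 + 1)) //.
apply: conn_trans (conn1 (subX.1 _ ur)) _.
apply: conn_trans (conn1 (subX.1 _ rz)) _.
by rewrite (head_mem rq v'q); apply: conn1 (subY.1 _ zv').
Qed.

Lemma splits_one c : splits c 3 (27 * c) (fun m n => m.*2 <= n).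
Proof.
move=> t gt n1; set n := size (labels t) in n1 *.
have [|d [tE dsmall dfew]] := @division_exists _ n./2 t; first by rewrite -/n; lia.
have gd : good c [::] (flat d) by rewrite tE.
have few : size (pieces d [::]) <= 12.
  move: dfew; rewrite -/n; set N := size _ => dfew.
  have : 3 * n < 13 * (n./2)./2.+1 by lia.
  by move=> /(leq_ltn_trans dfew); rewrite ltn_mul2r /= ltnS.
have [||X [vX cX SX]] := @gather _ adj _ (pieces d [::])
   (fun p => 3 * c * size (labels p.2) + 2 * c * size p.1)
   (fun p X => forall g h, g \in labels p.2 -> h \in p.1 -> linked g h -> joined 3 X g h).
- by move=> p X Y XY SX g h gp hp gh; apply: joined_sub XY (SX _ _ gp hp gh).
- by move=> p /(good_pieces gd)/goodE; apply: piece_one.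
exists [seq p.2 | p <- pieces d [::]], X; split=> //.
- move=> p /List.in_map_iff[p' [<- p'd]]; split.
    by apply: good_sub (good_pieces gd p'd).
  by have := dsmall _ p'd; lia.
- by rewrite -map_comp sumn_pieces tE.
- apply: leq_trans cX _.
  (* The lower labels of all pieces add up to [n], but the contexts overlap: each of the at most 12
     pieces may see all [n] labels above it. *)
  rewrite (_ : 27 * c * n = 3 * c * n + 12 * (2 * c * n)); last by lia.
  apply: (@leq_trans (3 * c * n + size (pieces d [::]) * (2 * c * n))); last first.
    by rewrite leq_add2l leq_mul2r few orbT.
  have {1}<- : sumn [seq size (labels p.2) | p <- pieces d [::]] = n by rewrite sumn_pieces tE.
  have : forall p, List.In p (pieces d [::]) -> size p.1 <= n.
    by move=> p /size_pieces_ctx; rewrite tE.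
  elim: (pieces d [::]) => //= p ps IH Hps.
  have {}IH := IH (fun p0 qps => Hps p0 (or_intror qps)).
  have H := Hps p (or_introl erefl).
  rewrite mulnDr mulSn addnACA leq_add // leq_add2l.
  by rewrite leq_mul2l H orbT.
- rewrite -tE => g h gt' ht' gh lgh.
  have [p pd [[gp hp]|[gp hp]|[hp gp]]] := linked_pieces adjC gd gt' ht' lgh.
  + by left; exists p.2 => //; apply/List.in_map_iff; exists p.
  + by right; apply: SX pd _ _ gp hp lgh.
  + by right; apply: joinedC; apply: SX pd _ _ hp gp _; rewrite linkedC.
Qed.

(** A group of [s'] may be spread over several groups of [s]; this suffices because [covers] speaks
    of vertices only. *)
Definition refines s' s := forall g v, g \in s' -> v \in g -> exists2 h, h \in s & v \in h.

Lemma refines_cat s1' s1 s2' s2 :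
  refines s1' s1 -> refines s2' s2 -> refines (s1' ++ s2') (s1 ++ s2).
Proof.
move=> r1 r2 g v; rewrite mem_cat => /orP[/r1 H|/r2 H] /H[h hs vh];
  by exists h; rewrite // mem_cat hs ?orbT.
Qed.

Lemma covers_refines c s1 s2 s1' s2' :
  refines s1' s1 -> refines s2' s2 -> covers c s1 s2 -> covers c s1' s2'.
Proof.
move=> r1 r2 [Q [szQ clQ HQ]]; exists Q; split=> // g h u v gs hs ug vh.
have [g' g's ug'] := r2 _ _ gs ug; have [h' h's vh'] := r1 _ _ hs vh.
exact: HQ g's h's ug' vh'.
Qed.

(** Groups that are cliques cover themselves. This is what turns [c] into [c + c] in the
    quotient. *)
Lemma covers_cliques c s1 s2 G :
  all clique G -> covers c s1 s2 -> covers (size G + c) (G ++ s1) s2.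
Proof.
move=> clG [Q [szQ clQ HQ]]; exists (G ++ Q); split.
- by rewrite size_cat leq_add2l.
- by rewrite all_cat clG clQ.
- move=> g h u v gs; rewrite mem_cat => /orP[hG|hs] ug vh uv.
    by exists h; rewrite // mem_cat hG.
  have [q qQ vq] := HQ _ _ _ _ gs hs ug vh uv.
  by exists q; rewrite // mem_cat qQ orbT.
Qed.

(** One cover for the whole chain against everything in and below it serves at each of its nodes,
    where fewer labels lie above and below. *)
Lemma good_chain c s G t :
  covers c (G ++ s) (G ++ labels t) -> good c (G ++ s) t ->
  good c s (foldr (@One _) t G).
Proof.
move=> cov gt.
suff H l s1 : {subset l <= G} -> {subset s1 <= G ++ s} -> good c s1 (foldr (@One _) t l).
  by apply: H => // x xs; rewrite mem_cat xs orbT.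
have labE : labels (foldr (@One _) t l) = l ++ labels t by elim: (l) => //= x l' ->.
elim: l s1 labE => [|x l IH] s1 labE lG s1G; first by apply: good_sub gt.
split.
  rewrite labE; apply: covers_sub cov => // y; rewrite !mem_cat => /orP[/lG->//|->].
  by rewrite orbT.
apply: IH; first by case: labE.
- by move=> y yl; apply: lG; rewrite inE yl orbT.
- move=> y; rewrite inE => /orP[/eqP->|/s1G//]; rewrite mem_cat lG //.
  by rewrite mem_head.
Qed.

Lemma labels_chain G t : labels (foldr (@One _) t G) = G ++ labels t.
Proof. by elim: G => //= x G ->. Qed.

(* Contracting every piece to one point leaves, for each hole of a piece, the
   groups of vertices above that hole lying in a common covering clique. *)
Lemma quotient c d s : good c s (flat d) -> exists T (M : seq (seq V * seq V)),
  [/\ size (labels T) <= c * size (pieces d s),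
      size M <= c * size (labels (flat d)),
      all clique (labels T) /\ (forall g h, (g, h) \in M -> g \in labels T),
      forall p g h u v, List.In p (pieces d s) -> g \in labels p.2 -> h \in p.1 ->
        u \in g -> v \in h -> adj u v ->
        h \in s \/ exists2 g', (g', h) \in M & v \in g' &
      refines (labels T) (labels (flat d)) /\
      forall s', refines s' s -> good (c + c) s' T].
Proof.
elim: d s => [t|K d IH|d1 IH1 d2 IH2] s /= gd.
- exists Leaf, [::]; split=> //.
    by move=> p g h u v [<-|] //= _ hs _ _ _; left.
  split=> // s' _; split=> //; by exists [::].
- have gK := good_plug gd; have [T [M [szT szM [clT MT] HM [refT gT]]]] := IH _ gK.
  have [Q [szQ /allP clQ HQ]] := goodE gK.
  (* Only the spine matters, since links from below the hole reach no other labels of the piece.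
     There is one group per covering clique, hence at most [c] per piece. *)
  pose grp q := [seq v <- flatten (spine K) | v \in q]; pose G := map grp Q.
  have clG : all clique G.
    apply/allP => _ /mapP[q qQ ->]; apply/cliqueP => u v.
    rewrite !mem_filter => /andP[uq _] /andP[vq _].
    by move/cliqueP: (clQ q qQ); apply.
  have refG : refines G (spine K).
    move=> _ v /mapP[q qQ ->]; rewrite mem_filter => /andP[_ /flattenP[h hK vh]].
    by exists h.
  have refGT : refines (G ++ labels T) (labels (plug K (flat d))).
    move=> g v gGT vg; have [h + vh] := refines_cat refG refT gGT vg.
    rewrite mem_cat => hKd; exists h => //; rewrite mem_plug.
    by case/orP: hKd => [/spine_sub->//|->]; rewrite orbT.
  (* [M] records from which original labels a group may draw its vertices. *)
  exists (foldr (@One _) T G), ([seq (grp q, h) | q <- Q, h <- spine K] ++ M); split.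
  + by rewrite labels_chain size_cat size_map mulnS leq_add.
  + rewrite size_cat size_allpairs size_plug mulnDr leq_add //.
    by rewrite leq_mul ?size_spine.
  + rewrite labels_chain all_cat clG clT; split=> // g h; rewrite !mem_cat.
    case/orP=> [/allpairsP[[q h'] /= [qQ h'K [-> _]]]|/MT->]; last by rewrite orbT.
    by rewrite map_f.
  + move=> p g h u v [<-/= _ hs _ _ _|pd gp hp ug vh uv]; first by left.
    have [|[g' g'M vg']] := HM _ _ _ _ _ pd gp hp ug vh uv; last first.
      by right; exists g'; rewrite // mem_cat g'M orbT.
    rewrite mem_cat => /orP[hK|]; [right|by left].
    have hKs : h \in spine K ++ s by rewrite mem_cat hK.
    have [q qQ vq] := HQ g h u v (pieces_sub pd gp) hKs ug vh uv.
    exists (grp q); first by rewrite mem_cat allpairs_f.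
    by rewrite mem_filter vq; apply/flattenP; exists h.
  + rewrite labels_chain; split=> // s' refs'.
    have refGs : refines (G ++ s') (spine K ++ s) by apply: refines_cat.
    have cov : covers (size G + c) (G ++ s') (G ++ labels T).
      exact: covers_cliques clG (covers_refines refs' refGT (goodE gd)).
    apply: good_chain; last exact: gT.
    by apply: covers_sub cov => //; rewrite size_map leq_add2r.
- case: gd => cov [gd1 gd2 no].
  have [T1 [M1 [szT1 szM1 [clT1 MT1] HM1 [refT1 gT1]]]] := IH1 _ gd1.
  have [T2 [M2 [szT2 szM2 [clT2 MT2] HM2 [refT2 gT2]]]] := IH2 _ gd2.
  exists (Two T1 T2), (M1 ++ M2); split.
  + by rewrite /= !size_cat mulnDr leq_add.
  + by rewrite !size_cat mulnDr leq_add.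
  + rewrite /= all_cat clT1 clT2; split=> // g h; rewrite !mem_cat.
    by case/orP=> [/MT1->|/MT2->]; rewrite ?orbT.
  + move=> p g h u v /List.in_app_iff[pd|pd] gp hp ug vh uv.
      have [?|[g' g'M vg']] := HM1 _ _ _ _ _ pd gp hp ug vh uv; first by left.
      by right; exists g'; rewrite // mem_cat g'M.
    have [?|[g' g'M vg']] := HM2 _ _ _ _ _ pd gp hp ug vh uv; first by left.
    by right; exists g'; rewrite // mem_cat g'M orbT.
  + split; first exact: refines_cat.
    move=> s' refs'; split.
      apply: covers_sub (covers_refines refs' (refines_cat refT1 refT2) cov) => //.
      by rewrite leq_addr.
    split; [exact: gT1|exact: gT2|move=> g h gT hT; apply/negP].
    move=> /linkedP[u [v [ug vh uv]]].
    have [g' g'd ug'] := refT1 _ _ gT ug; have [h' h'd vh'] := refT2 _ _ hT vh.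
    have /negP[] := no _ _ g'd h'd; apply/linkedP; by exists u, v.
Qed.


(* The path of length [f + 5] is u - r - z'' - r0 ~f~ v0 - z' - v: r lies in a
   group with head z'', the final vertex in a group with head z', and the two
   groups are joined by the net of the quotient. *)
Lemma splits_step (R : realDomainType) (al : R -> R) c f A :
  {homo al : x y / (x <= y)%R} ->
  (forall n, 1 < n -> exists2 a, (al n%:R = a%:R)%R & 0 < a < n) ->
  (forall t, good (c + c) [::] t -> exists X, [/\ valid X,
     ((cost X)%:R <= (A * size (labels t))%:R * al (size (labels t))%:R)%R &
     solved adj f X t]) ->
  splits c (f + 5) (5 * c + 12 * c * A) (fun m n => m%:R <= al n%:R)%R.
Proof.
move=> al_mono al_nat inner t gt n1; set n := size (labels t) in n1 *.
have [a alE /andP[a0 an]] := al_nat n n1.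
(* For small [a] the quotient need not be smaller than [t], but then solving [t] itself at the lower
   level costs only O(n). *)
have [ac|ca] := ltnP a (6 * c).
  have [|X [vX cX sX]] := inner t; first by apply: good_sub gt => //; rewrite leq_addr.
  exists [::], X; split=> //.
    move: cX; rewrite -/n alE -natrM ler_nat => /leq_trans; apply.
    rewrite mulnAC leq_mul2r; apply/orP; right; nia.
  move=> g h gt' ht' gh lgh; right; apply: (@joined_le _ f); first by rewrite leq_addr.
  exact: sX.
have [|d [tE dsmall dfew]] := @division_exists _ a t; first by rewrite a0 ltnW.
have gd : good c [::] (flat d) by rewrite tE.
have [T [M [szT szM [clT MT] HM [_ gT]]]] := quotient gd.
have [|I [vI cI sI]] := inner T; first exact: gT.
have clT' g u v : g \in labels T -> u \in g -> v \in g -> adj u v.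
  by move=> /(allP clT)/cliqueP; apply.
have {}cI : cost I <= 6 * c * A * n.
  have wa : size (labels T) * a <= 6 * c * n.
    apply: (@leq_trans (c * size (pieces d [::]) * a)); first by rewrite leq_mul2r szT orbT.
    move: dfew; rewrite -/n; set N := size (pieces _ _) => dfew.
    have : N * a <= N * (2 * (a./2).+1) by rewrite leq_mul2l; apply/orP; right; lia.
    nia.
  (* With [T] no larger than [t], monotonicity bounds [al] at its size by [a], which cancels against
     the factor 1/a in the number of groups. *)
  have wn : size (labels T) <= n.
    by rewrite -(leq_pmul2r a0); apply: leq_trans wa _; rewrite mulnC leq_mul2l ca orbT.
  rewrite -(ler_nat R); apply: le_trans cI _.
  apply: (@le_trans _ _ ((A * size (labels T))%:R * a%:R)%R).
    by rewrite ler_wpM2l // -alE; apply: al_mono; rewrite ler_nat.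
  by rewrite -natrM ler_nat -mulnA (mulnC (6 * c)) -mulnA leq_mul2l wa orbT.
(* [Y1]: in each group, star edges from the head to the ports of the quotient net. *)
have [||Y1 [vY1 cY1 SY1]] := @gather_seq _ adj _ I.2 1
  (fun gy Y => gy.1 \in labels T -> (head gy.2 gy.1, gy.2) \in Y.1).
- by move=> [g y] X Y [sub1 sub2] SX /= /SX/sub1.
- move=> [g y] gyI; exists (if g \in labels T then ([:: (head y g, y)], [::]) else ([::], [::])).
  have yg : y \in g by case/andP: vI => _ /allP/(_ _ gyI).
  case: ifP => gIT; last by split.
  by split=> //=; rewrite ?mem_head // /valid /= (clT' g) ?head_in.
(* [Y2]: for each label of a piece and each clique covering its context, one representative r,
   joined to the label and to the head of a group containing r. *)
have [||Y2 [vY2 cY2 SY2]] := @gather _ adj _ (pieces d [::])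
   (fun p => 3 * c * size (labels p.2))
   (fun p X => forall g h u v, g \in labels p.2 -> h \in p.1 -> u \in g -> v \in h -> adj u v ->
      exists u' r g', [/\ (g, u') \in X.2, (u', r) \in X.1, (head r g', r) \in X.1,
        r \in g' /\ g' \in labels T & adj r v]).
- move=> p X Y [sub1 sub2] SX g h u v gp hp ug vh uv.
  have [u' [r [g' [? ? ? ? ?]]]] := SX _ _ _ _ gp hp ug vh uv.
  by exists u', r, g'; split; rewrite ?sub1 ?sub2.
- move=> p pd; have [Q [szQ /allP clQ HQ]] := goodE (good_pieces gd pd).
  have [||X [vX cX SX]] := @gather_seq _ adj _ [seq (g, q) | g <- labels p.2, q <- Q] 3
    (fun gq X => (exists h u r, [/\ h \in p.1, u \in gq.1, r \in h, r \in gq.2 & adj u r]) ->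
      exists u' r g', [/\ (gq.1, u') \in X.2, (u', r) \in X.1, (head r g', r) \in X.1,
        r \in g' /\ g' \in labels T & r \in gq.2]).
  + move=> [g q] X Y [sub1 sub2] SX /SX[u' [r [g' [? ? ? ? ?]]]].
    by exists u', r, g'; split; rewrite ?sub1 ?sub2.
  + move=> [g q] /allpairsP[[g1 q1] [/= gp qQ [-> ->]]].
    case: (pselect (exists h u r,
      [/\ h \in p.1, u \in g1, r \in h, r \in q1 & adj u r])); last by exists ([::], [::]).
    move=> [h [u [r [hp ug rh rq ur]]]].
    have [//|[g' g'M rg']] := HM _ _ _ _ _ pd gp hp ug rh ur.
    exists ([:: (u, r); (head r g', r)], [:: (g1, u)]); split=> //.
      by rewrite /valid /= ur ug (clT' g') ?head_in // (MT _ _ g'M).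
    move=> _; exists u, r, g'; split; rewrite ?inE ?eqxx ?orbT //.
    by split=> //; apply: MT g'M.
  exists X; split=> //.
    apply: leq_trans cX _; rewrite size_allpairs -mulnA leq_mul2l /= mulnC.
    by rewrite leq_mul2r szQ orbT.
  move=> g h u v gp hp ug vh uv; have [q qQ vq] := HQ _ _ _ _ gp hp ug vh uv.
  have [|u' [r [g' [? ? ? ? rq]]]] := SX (g, q) (allpairs_f _ gp qQ).
    by exists h, u, v.
  exists u', r, g'; split=> //.
  by move/cliqueP: (clQ q qQ); apply.
(* [Y3]: from the head of each group, one edge into each original label it draws from. *)
have [||Y3 [vY3 cY3 SY3]] := @gather_seq _ adj _ M 2
  (fun gh Y => (exists v, v \in gh.1 /\ v \in gh.2) ->
     exists v, [/\ v \in gh.1, (gh.2, v) \in Y.2 & (head v gh.1, v) \in Y.1]).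
- move=> [q h] X' Y [sub1 sub2] SY /SY[v [vq hv zv]].
  by exists v; split; rewrite ?sub1 ?sub2.
- move=> [q h] qhM.
  case: (pselect (exists v, v \in q /\ v \in h)); last by exists ([::], [::]).
  move=> [v [vq vh]]; exists ([:: (head v q, v)], [:: (h, v)]).
  split=> //; first by rewrite /valid /= vh (clT' q) ?head_in // (MT _ _ qhM).
  by move=> _; exists v; split; rewrite ?inE ?eqxx ?orbT.
(* The ports of [I] belong to groups, not to labels of [t], so only its edges are kept. *)
pose X0 : net V := (I.1, [::]).
pose X := netcat X0 (netcat Y1 (netcat Y2 Y3)).
exists [seq p.2 | p <- pieces d [::]], X; split=> //.
- move=> p /List.in_map_iff[p' [<- p'd]]; split.
    by apply: good_sub (good_pieces gd p'd).
  by rewrite -/n alE ler_nat; apply: dsmall.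
- by rewrite -map_comp sumn_pieces tE.
- rewrite /X !valid_cat vY1 vY2 vY3 !andbT.
  by case/andP: vI => vI1 _; rewrite /valid /= vI1.
- have c2 : cost Y2 <= 3 * c * n.
    apply: leq_trans cY2 _; rewrite /n -tE -(sumn_pieces d [::]).
    by elim: (pieces d [::]) => //= p ps IH; rewrite mulnDr leq_add2l.
  have c3 : cost Y3 <= 2 * (c * n).
    by apply: leq_trans cY3 _; rewrite leq_mul2l /= /n -tE.
  move: cI cY1 c2 c3; rewrite /X !cost_cat mulnDl.
  have -> : 12 * c * A * n = 2 * (6 * c * A * n) by lia.
  rewrite -!(mulnA _ c n); move: (c * n) (6 * c * A * n) => cn cAn.
  by rewrite /cost /=; lia.
- have sI1 : {subset I.1 <= X.1} by move=> e; rewrite /X /= mem_cat => ->.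
  have [s1 s1'] : subnet Y1 X.
    exact: subnet_trans (subnet_catl _ _) (subnet_catr _ _).
  have [s2 s2'] : subnet Y2 X.
    apply: subnet_trans (subnet_catr _ _); apply: subnet_trans (subnet_catr _ _).
    exact: subnet_catl.
  have [s3 s3'] : subnet Y3 X.
    apply: subnet_trans (subnet_catr _ _); apply: subnet_trans (subnet_catr _ _).
    exact: subnet_catr.
  have main p g h : List.In p (pieces d [::]) -> g \in labels p.2 -> h \in p.1 ->
      linked g h -> joined (f + 5) X g h.
    move=> pd gp hp /linkedP[u [v [ug vh uv]]].
    have [u' [r [g2 [gu' ur z2r [rg2 g2T] rv]]]] := SY2 _ pd _ _ _ _ gp hp ug vh uv.
    have [//|[g1 g1M vg1]] := HM _ _ _ _ _ pd gp hp ug vh uv.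
    have [|v' [v'g1 hv' z1v']] := SY3 _ g1M; first by exists v.
    exists u', v'; split; [exact: s2'|exact: s3'|].
    have into : conn X.1 2 u' (head r g2).
      exact: (conn_trans (conn1 (s2 _ ur)) (conn1C (s2 _ z2r))).
    have outof : conn X.1 1 (head v' g1) v' := conn1 (s3 _ z1v').
    have [g12|g12] := eqVneq g2 g1.
      apply: (@conn_le _ _ 3); first by (clear; lia).
      move: into; rewrite g12 in rg2 *; rewrite (head_mem rg2 v'g1) => into.
      exact: (conn_trans into outof).
    (* The groups of r and v are distinct but linked, since r and v lie in a common clique. *)
    have g1T := MT _ _ g1M.
    have [|r0 [v0 [p1 p2 rv0]]] := sI _ _ g2T g1T g12.
      by apply/linkedP; exists r, v.
    have [r0g v0g] : r0 \in g2 /\ v0 \in g1.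
      by case/andP: vI => _ /allP vI2; split; [exact: (vI2 _ p1)|exact: (vI2 _ p2)].
    have e1 : conn X.1 1 (head r0 g2) r0 := conn1 (s1 _ (SY1 _ p1 g2T)).
    have e2 : conn X.1 1 v0 (head v0 g1) := conn1C (s1 _ (SY1 _ p2 g1T)).
    have -> : f + 5 = 2 + (1 + (f + (1 + 1))) by (clear; lia).
    apply: conn_trans into _; rewrite (head_mem rg2 r0g).
    apply: conn_trans e1 _; apply: conn_trans (conn_sub sI1 rv0) _.
    apply: conn_trans e2 _; by rewrite (head_mem v0g v'g1).
  rewrite -tE => g h gt' ht' gh lgh.
  have [p pd [[gp hp]|[gp hp]|[hp gp]]] := linked_pieces adjC gd gt' ht' lgh.
  + by left; exists p.2 => //; apply/List.in_map_iff; exists p.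
  + by right; apply: main pd gp hp lgh.
  + by right; apply: joinedC; apply: main pd hp gp _; rewrite linkedC.
Qed.

End Levels.

Local Open Scope classical_set_scope.
Local Open Scope ring_scope.

(** * The inverse Ackermann hierarchy *)

Section Alpha.
Variable R : realType.
Implicit Types (x y : R) (k n m : nat).

Lemma inf_nat (P : nat -> Prop) m : P m -> (forall n, P n -> (m <= n)%N) ->
  inf [set (n%:R : R) | n in P] = m%:R.
Proof.
move=> Pm minm; apply/eqP; rewrite eq_le; apply/andP; split.
  by apply: ge_inf; [exists 0 => _ [n _ <-]|exists m].
by apply: lb_le_inf; [exists m%:R, m|move=> _ [n Pn <-]; rewrite ler_nat minm].
Qed.

Lemma iter_reach (f : R -> R) :
  (forall n x, x <= n.+2%:R -> f x <= n.+1%:R) ->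
  forall n x, x <= n.+1%:R -> iter n f x <= 1.
Proof. by move=> fle; elim=> [|n IH] x // /fle; rewrite iterSr; apply: IH. Qed.

Lemma alphaS_min k x :
  (forall n y, y <= n.+2%:R -> alpha k y <= n.+1%:R :> R) ->
  exists m, [/\ alpha k.+1 x = m%:R, iter m (alpha k) x <= 1 &
    forall n, iter n (alpha k) x <= 1 -> (m <= n)%N].
Proof.
move=> /iter_reach reach.
have ex : exists n, iter n (alpha k) x <= 1.
  have [x1|x1] := leP x 1; first by exists 0.
  exists (Num.bound x); apply: reach.
  apply/ltW/(lt_trans (archi_boundP (le_trans ler01 (ltW x1)))).
  by rewrite ltr_nat.
exists (ex_minn ex); case: ex_minnP => m Pm minm; split=> //.
exact: (inf_nat Pm minm).
Qed.

(** Every level lowers an integer bound above 1 by at least one, so iterating it reaches 1 and the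
    infimum defining the next level is a minimum. The two facts feed each other in the induction. *)
Lemma alpha_le k n x : x <= n.+2%:R -> alpha k x <= n.+1%:R.
Proof.
elim: k n x => [|k IH] n x xn.
  rewrite /= ler_pdivrMr // -natrM; apply: le_trans xn _; rewrite ler_nat; lia.
have [m [-> _ minm]] := alphaS_min x IH; rewrite ler_nat; apply: minm.
exact: iter_reach.
Qed.

Lemma alphaSP k x : exists m, [/\ alpha k.+1 x = m%:R, iter m (alpha k) x <= 1 &
  forall n, iter n (alpha k) x <= 1 -> (m <= n)%N].
Proof. by apply: alphaS_min => n y; apply: alpha_le. Qed.

Lemma alpha_mono k : {homo @alpha R k : x y / x <= y}.
Proof.
elim: k => [|k IH] x y xy; first by rewrite /= ler_pM2r ?invr_gt0.
have [m [-> itm minm]] := alphaSP k x; have [m' [-> itm' _]] := alphaSP k y.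
rewrite ler_nat; apply: minm; apply: le_trans itm'.
by elim: m' => //= m' IHm; apply: IH.
Qed.

Lemma alpha_ge1 k n : (1 < n)%N -> 1 <= alpha k n%:R :> R.
Proof.
case: k => [|k] n1; first by rewrite /= ler_pdivlMr // mul1r ler_nat.
have [[|m] [-> + _]] := alphaSP k n%:R; last by rewrite ler1n.
by rewrite /= lern1 leqNgt n1.
Qed.

Lemma alphaS_nat k n : (1 < n)%N ->
  exists2 a, alpha k.+1 n%:R = a%:R :> R & (0 < a < n)%N.
Proof.
move=> n1; have [a [aE _ _]] := alphaSP k n%:R; exists a => //.
rewrite -(ltr0n R) -aE (lt_le_trans _ (alpha_ge1 _ n1)) //=.
case: n n1 aE => [|[|n]] // _ aE; rewrite ltnS -(ler_nat R) -aE; exact: alpha_le.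
Qed.

Definition solvable k f c B := forall (V : eqType) (adj : rel V) (t : tree (seq V)),
  symmetric adj -> good adj c [::] t ->
  exists X, [/\ valid adj X,
    (cost X)%:R <= (B * size (labels t))%:R * alpha k (size (labels t))%:R :> R &
    solved adj f X t].

Lemma splits_solvable k f c B :
  (forall (V : eqType) (adj : rel V), symmetric adj ->
    splits adj c f B (fun m n => m%:R <= alpha k n%:R :> R)) ->
  solvable k.+1 f c B.
Proof.
move=> step V adj t adjC gt.
have [j [jE itj _]] := alphaSP k (size (labels t))%:R.
have [X [vX cX sX]] :=
  unroll (@alpha_mono k) (step V adj adjC) gt itj.
by exists X; split=> //; rewrite jE -natrM ler_nat.
Qed.

Lemma solvable_exists k c : exists B, solvable k.+1 (3 + 5 * k) c B.
Proof.
elim: k c => [|k IH] c.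
  exists (27 * c)%N; apply: splits_solvable => V adj adjC t gt n1.
  have [ts [X [Hts szts vX cX HX]]] := splits_one adjC gt n1.
  exists ts, X; split=> // p /Hts[gp le2]; split=> //=.
  by rewrite ler_pdivlMr // -natrM ler_nat muln2.
(* The quotient is solved one level lower with twice as many cliques, so [c] must vary in the
   induction. *)
have [B HB] := IH (c + c)%N; exists (5 * c + 12 * c * B)%N.
have -> : (3 + 5 * k.+1 = 3 + 5 * k + 5)%N by lia.
apply: splits_solvable => V adj adjC.
apply: splits_step => //; [exact: alpha_mono|exact: alphaS_nat|].
by move=> t; apply: HB.
Qed.

End Alpha.

(** * Shifted quadtrees of fat objects *)

Section Forest.
Variables (V K : eqType) (adj : rel V) (ky : nat -> V -> K) (lev : V -> nat) (ok : pred V).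
Variable c : nat.
Hypothesis adj_ky : forall l i j, ok i -> ok j -> (lev i <= l)%N -> (lev j <= l)%N ->
  adj i j -> ky l i = ky l j.
Hypothesis adj_lev0 : forall i j, lev i = 0 -> lev j = 0 -> ~~ adj i j.
Hypothesis cov : forall l k (A B : seq V), (0 < l)%N ->
  {in A, forall j, ok j && (l <= lev j)%N} ->
  {in B, forall i, [&& ok i, (lev i <= l)%N & ky l i == k]} ->
  covers adj c (map (fun v => [:: v]) A) (map (fun v => [:: v]) B).

Local Notation sing := (map (fun v : V => [:: v])).

Lemma covers_nil s : covers adj c [::] s.
Proof. by exists [::]. Qed.

Lemma good_two (C S1 S2 : seq V) t1 t2 :
  perm_eq (labels t1) (sing S1) -> perm_eq (labels t2) (sing S2) ->
  covers adj c (sing C) (sing (S1 ++ S2)) ->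
  good adj c (sing C) t1 -> good adj c (sing C) t2 ->
  {in S1 & S2, forall i j, ~~ adj i j} -> good adj c (sing C) (Two t1 t2).
Proof.
move=> p1 p2 cv g1 g2 no; split.
  apply: covers_sub cv => // g; rewrite /= mem_cat map_cat mem_cat.
  by rewrite (perm_mem p1) (perm_mem p2).
split=> // g h; rewrite (perm_mem p1) (perm_mem p2).
move=> /mapP[i iS ->] /mapP[j jS ->]; apply/negP => /linkedP[u [v []]].
by rewrite !inE => /eqP-> /eqP->; apply/negP/no.
Qed.

(** [ky l i] names the level-l cell of i, and [C] holds the vertices of larger cells above. The tree
    follows the cells downwards, each cell carrying its own-level vertices as a chain on top of its
    subtree. *)
Lemma forest_exists l (S C : seq V) :
  {in S, forall i, ok i && (lev i <= l)%N} ->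
  {in C, forall j, ok j && (l < lev j)%N} ->
  C = [::] \/ (exists k, {in S, forall i, ky l.+1 i = k}) ->
  exists t, perm_eq (labels t) (sing S) /\ good adj c (sing C) t.
Proof.
elim: l S C => [|l IH] S C.
  move=> okS okC kC.
  have cS S' : {subset S' <= S} -> covers adj c (sing C) (sing S').
    move=> sub; case: kC okC => [->|[k kS]] okC; first exact: covers_nil.
    apply: (cov (l := 1) (k := k)) => // i /sub iS; have /andP[oki li] := okS _ iS.
    by rewrite oki (kS _ iS) eqxx (leq_trans li).
  elim: S okS {kC} cS => [|i S IHS] /=.
    by move=> _ cS; exists Leaf; split=> //; split=> //; apply: (cS [::]).
  move=> okS cS.
  have [|S' subS'|t [pt gt]] := IHS => //.
  - by move=> j jS; apply: okS; rewrite inE jS orbT.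
  - by apply: cS => j /subS' jS; rewrite inE jS orbT.
  exists (Two (One [:: i] Leaf) t); split; first by rewrite /= perm_cons.
  apply: (@good_two C [:: i] S) => //; first exact: cS.
  - split; first by apply: (cS [:: i]) => j; rewrite !inE => ->.
    by split=> //; exists [::].
  - move=> j j'; rewrite inE => /eqP-> j'S; apply: adj_lev0.
    + have /andP[_] := okS i (mem_head _ _); lia.
    + have /andP[_] := okS j' (mem_behead (s := i :: S) j'S); lia.
(* The inner induction splits off one cell of level [l.+1] at a time. *)
move: {2}(size S).+1 (ltnSn (size S)) => N; elim: N S => [//|N IHN] S.
move=> szS okS okC kC.
have cS S' : {subset S' <= S} -> covers adj c (sing C) (sing S').
  move=> sub; case: kC okC => [->|[k kS]] okC; first exact: covers_nil.
  apply: (cov (l := l.+2) (k := k)) => // i /sub iS; have /andP[oki li] := okS _ iS.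
  by rewrite oki (kS _ iS) eqxx (leq_trans li).
case: S szS okS kC cS => [|i0 S'] szS okS kC cS.
  by exists Leaf; split=> //; split=> //; apply: (cS [::]).
set S := i0 :: S' in szS okS kC cS *; set k0 := ky l.+1 i0.
pose S1 := [seq i <- S | ky l.+1 i == k0]; pose S2 := [seq i <- S | ky l.+1 i != k0].
pose X := [seq i <- S1 | lev i == l.+1]; pose Y := [seq i <- S1 | lev i != l.+1].
have sub1 : {subset S1 <= S} by apply: mem_subseq; apply: filter_subseq.
have sub2 : {subset S2 <= S} by apply: mem_subseq; apply: filter_subseq.
have [|||t2 [pt2 gt2]] := IHN S2 _ _ okC.
- have : (count (predC (fun i => ky l.+1 i != k0)) S > 0)%N by rewrite /= negbK eqxx.
  by move: szS; rewrite size_filter -(count_predC (fun i => ky l.+1 i != k0) S); lia.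
- by move=> i /sub2/okS.
- by case: kC => [->|[k kS]]; [left|right; exists k => i /sub2/kS].
have X1 i : i \in X -> [/\ i \in S, ky l.+1 i = k0 & lev i = l.+1].
  by rewrite !mem_filter => /and3P[/eqP-> /eqP-> ->].
have Y1 i : i \in Y -> [/\ i \in S, ky l.+1 i = k0 & (lev i <= l)%N].
  rewrite !mem_filter => /and3P[lne /eqP-> iS]; split=> //.
  by have /andP[_] := okS i iS; lia.
have okXC : {in X ++ C, forall j, ok j && (l.+1 <= lev j)%N}.
  move=> j; rewrite mem_cat => /orP[/X1[jS _ ->]|/okC/andP[-> /ltnW->//]].
  by have /andP[-> _] := okS j jS; rewrite leqnn.
have okXY : {in X ++ Y, forall i, [&& ok i, (lev i <= l.+1)%N & ky l.+1 i == k0]}.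
  by move=> i; rewrite mem_cat => /orP[/X1|/Y1] [iS -> _]; rewrite eqxx andbT; apply: okS.
have [||t1 [pt1 gt1]] := IH Y (X ++ C) _ okXC.
- by move=> i /Y1[iS _ ->]; have /andP[->] := okS i iS.
- by right; exists k0 => i /Y1[].
exists (Two (foldr (@One _) t1 (sing X)) t2).
have p1 : perm_eq (labels (foldr (@One _) t1 (sing X))) (sing S1).
  rewrite labels_chain; apply: (@perm_trans _ (sing X ++ sing Y)).
    by rewrite perm_cat2l.
  by rewrite -map_cat; apply: perm_map; apply: permEl (perm_filterC _ S1).
split.
  apply: (@perm_trans _ (sing S1 ++ sing S2)); first by rewrite perm_cat.
  by rewrite -map_cat; apply: perm_map; apply: permEl (perm_filterC _ S).
apply: (@good_two C S1 S2) => //.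
- by apply: cS => i; rewrite mem_cat => /orP[/sub1|/sub2].
- apply: good_chain; rewrite -map_cat //.
  apply: covers_sub (cov _ okXC okXY) => // g.
  by rewrite map_cat !mem_cat (perm_mem pt1).
- move=> i j iS1 jS2; apply/negP => ij.
  have /andP[oki li] := okS i (sub1 _ iS1); have /andP[okj lj] := okS j (sub2 _ jS2).
  move: (adj_ky oki okj li lj ij) iS1 jS2; rewrite !mem_filter => -> /andP[-> _].
  by [].
Qed.

End Forest.

(** * Enclosing cubes and shifted grids *)

Section Boxes.
Variables (R : realType) (d : nat).
Implicit Types (A : set (pt R d)) (l e : R).

Lemma sidelen_le A a l : 0 <= l -> A `<=` cube a l -> sidelen A <= l.
Proof.
move=> l0 Al; apply: ge_inf; first by exists 0 => x [].
by split=> //; exists a.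
Qed.

Lemma enclosing_cube A e : bounded_obj A -> sidelen A < e ->
  exists a l, [/\ 0 <= l, l < e & A `<=` cube a l].
Proof.
move=> [a0 [l0 [l00 Al0]]] /inf_lt[|l [l1 [a Al]] le]; last by exists a, l.
by exists l0; split=> //; exists a0.
Qed.

Lemma sidelen_le0_subset1 A x y : bounded_obj A -> sidelen A <= 0 -> A x -> A y -> x = y.
Proof.
move=> bA A0 Ax Ay; apply/funext => t; apply/eqP; rewrite -subr_eq0 -normr_le0.
apply/ler_addgt0Pr => e e0; rewrite add0r.
have [a [l [_ le Al]]] := enclosing_cube bA (le_lt_trans A0 e0).
have /(_ t)/andP[x1 x2] := Al _ Ax; have /(_ t)/andP[y1 y2] := Al _ Ay.
by rewrite ler_norml; apply/andP; split; lra.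
Qed.

(* For distinct shifts, the grids Z + s/D and Z + s'/D are disjoint subsets of
   (1/D) Z, of which the open interval (y, y + 1/D) contains at most one point. *)
Lemma floor_shift_inj (D s s' : nat) (y w w' : R) : (s < D)%N -> (s' < D)%N ->
  y <= w < y + D%:R^-1 -> y <= w' < y + D%:R^-1 ->
  Num.floor (w - s%:R / D%:R) != Num.floor (y - s%:R / D%:R) ->
  Num.floor (w' - s'%:R / D%:R) != Num.floor (y - s'%:R / D%:R) -> s = s'.
Proof.
move=> sD s'D.
have D0 : 0 < D%:R :> R by rewrite ltr0n (leq_ltn_trans _ sD).
have between (z : nat) v : y <= v < y + D%:R^-1 ->
    Num.floor (v - z%:R / D%:R) != Num.floor (y - z%:R / D%:R) ->
    y * D%:R < (Num.floor (v - z%:R / D%:R) * D%:Z + z%:Z)%:~R < y * D%:R + 1.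
  move=> /andP[yv vy] ne; set K := Num.floor (v - _).
  have yK : y - z%:R / D%:R < K%:~R.
    rewrite -floor_lt_int lt_neqAle eq_sym ne /=.
    by apply: le_floor; rewrite lerB.
  have Kv : K%:~R <= v - z%:R / D%:R := floor_le _.
  have yz : (y - z%:R / D%:R) * D%:R = y * D%:R - z%:R by rewrite mulrBl divfK ?gt_eqF.
  have vz : (v - z%:R / D%:R) * D%:R = v * D%:R - z%:R by rewrite mulrBl divfK ?gt_eqF.
  have vy1 : v * D%:R < y * D%:R + 1.
    have : v * D%:R < (y + D%:R^-1) * D%:R by rewrite ltr_pM2r.
    by rewrite mulrDl mulVf ?gt_eqF.
  move: yK; rewrite -(ltr_pM2r D0) yz => yK; move: Kv; rewrite -(ler_pM2r D0) vz => Kv.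
  rewrite rmorphD rmorphM /= -!pmulrn; apply/andP; split; lra.
move=> yw yw' /(between _ _ yw) /= + /(between _ _ yw') /=.
set P := (_ * _ + _)%R; set P' := (Num.floor (w' - _) * _ + _)%R.
move=> /andP[p1 p2] /andP[q1 q2].
have le_int (p q : int) : p%:~R < y * D%:R + 1 -> y * D%:R < q%:~R -> p <= q.
  move=> py yq; rewrite -ltzD1 -(ltr_int R) rmorphD /=; lra.
have PP : P = P' by apply/eqP; rewrite eq_le !le_int.
have : (P %% D = P' %% D)%Z by rewrite PP.
by rewrite !modzMDl !modz_nat => -[]; rewrite !modn_small.
Qed.

(** The grids are nested: with b = D+1, a coarse corner u b (K + s/D) equals u (K b + s + s/D), a
    fine corner with the same shift. *)
Lemma floor_coarsen (D s : nat) (x y u : R) : 0 < u -> (0 < D)%N ->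
  Num.floor (x / u - s%:R / D%:R) = Num.floor (y / u - s%:R / D%:R) ->
  Num.floor (x / (u * D.+1%:R) - s%:R / D%:R) = Num.floor (y / (u * D.+1%:R) - s%:R / D%:R).
Proof.
move=> u0 D0.
have D0' : 0 < D%:R :> R by rewrite ltr0n.
have E z : z / (u * D.+1%:R) - s%:R / D%:R = ((z / u - s%:R / D%:R) - s%:R) / D.+1%:R.
  rewrite -natr1; field.
  by rewrite ?(gt_eqF u0) ?(gt_eqF D0') ?(gt_eqF (addr_gt0 D0' ltr01)).
rewrite !E; move: (x / u - _) (y / u - _) => {E u u0 x y}.
suff H (X Y : R) : Num.floor X = Num.floor Y ->
    Num.floor ((X - s%:R) / D.+1%:R) <= Num.floor ((Y - s%:R) / D.+1%:R).
  by move=> X Y XY; apply/eqP; rewrite eq_le !H.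
move=> XY; rewrite floor_ge_int ler_pdivlMr ?ltr0n //; set K := Num.floor (_ / _).
have : K%:~R <= (X - s%:R) / D.+1%:R := floor_le _.
rewrite ler_pdivlMr ?ltr0n // => KX.
have : (K * D.+1%:Z + s%:Z)%:~R <= Y.
  rewrite -floor_ge_int -XY floor_ge_int rmorphD rmorphM /= -!pmulrn; lra.
rewrite rmorphD rmorphM /= -!pmulrn; lra.
Qed.

End Boxes.

(** * Quadtrees of a fat collection *)

Section FatForest.
Variables (R : realType) (d c n : nat) (O : 'I_n -> set (pt R d)).
Hypotheses (bO : forall i, bounded_obj (O i)) (fO : fat c O).

Definition big i := 0 < sidelen (O i).

(* Two point-like objects are never adjacent: fatness says nothing about them. *)
Definition fadj i j := `[< O i `&` O j !=set0 >] && (big i || big j).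

Lemma fadjC : symmetric fadj.
Proof. by move=> i j; rewrite /fadj setIC orbC. Qed.

Local Notation D := (2 * d).+1.

(** The base scale [e] is at most every positive side length, so that exactly the point-like objects
    fall to level 0. The factor 2 turns the infimum [sidelen] into a strict bound, which yields a
    cube. *)
Lemma enclosures : exists e (a : 'I_n -> pt R d) (r : 'I_n -> R), [/\ 0 < e,
  forall i, O i `<=` cube (a i) (r i), forall i, 0 <= r i,
  forall i, big i -> e <= r i <= 2 * sidelen (O i) &
  forall i, ~~ big i -> r i < e / D%:R].
Proof.
pose e := \big[Order.min/1]_(i | big i) sidelen (O i).
have e0 : 0 < e by apply: lt_bigmin.
have D0 : 0 < D%:R :> R by rewrite ltr0n.
have [ar Har] : {ar : 'I_n -> pt R d * R & forall i, [/\ O i `<=` cube (ar i).1 (ar i).2,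
    0 <= (ar i).2, big i -> e <= (ar i).2 <= 2 * sidelen (O i) &
    ~~ big i -> (ar i).2 < e / D%:R]}.
  apply: (@choice _ _ (fun i (ar : pt R d * R) => [/\ O i `<=` cube ar.1 ar.2,
    0 <= ar.2, big i -> e <= ar.2 <= 2 * sidelen (O i) & ~~ big i -> ar.2 < e / D%:R])) => i.
  have [bi|si] := boolP (big i).
    have [|a [l [l0 le Ol]]] := @enclosing_cube _ _ (O i) (2 * sidelen (O i)) (bO i).
      by rewrite ltr_pMl // ltr1n.
    exists (a, l); split=> //= _; rewrite (ltW le) andbT.
    have ei : e <= sidelen (O i) by apply: bigmin_le_cond.
    exact: le_trans ei (sidelen_le l0 Ol).
  have [|a [l [l0 le Ol]]] := @enclosing_cube _ _ (O i) (e / D%:R) (bO i).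
    by move: si; rewrite /big -leNgt => /le_lt_trans; apply; rewrite divr_gt0.
  by exists (a, l).
by exists e, (fun i => (ar i).1), (fun i => (ar i).2); split=> // i; have [] := Har i.
Qed.

Lemma fat_forest : exists al : 'I_D -> pred 'I_n,
  (forall i j, exists s, al s i && al s j) /\
  forall s, exists t, perm_eq (labels t) [seq [:: i] | i <- enum (al s)] /\
    good fadj (#|{ffun 'I_d -> 'I_(2 * D * D.+1)}| * c) [::] t.
Proof.
have [e [a [r [e0 Or r0 rbig rsmall]]]] := enclosures.
have D0 : 0 < D%:R :> R by rewrite ltr0n.
pose u (l : nat) : R := e * D.+1%:R ^+ l.
have u0 l : 0 < u l by rewrite mulr_gt0 // exprn_gt0 // ltr0n.
have uS l : u l.+1 = u l * D.+1%:R by rewrite /u exprSr mulrA.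
have u_mono l m : (l <= m)%N -> u l <= u m.
  by move=> lm; rewrite ler_pM2l // ler_weXn2l // ler1n.
have levex i : exists l, r i < u l / D%:R.
  exists (Num.bound (r i * D%:R / e)); rewrite ltr_pdivlMr // /u (mulrC e) -ltr_pdivrMr //.
  have : 0 <= r i * D%:R / e by rewrite divr_ge0 ?mulr_ge0 // ?ltW.
  move=> /archi_boundP; set m := Num.bound _ => rm.
  apply: lt_le_trans rm _.
  by rewrite -natrX ler_nat; apply: ltnW; apply: ltn_expl.
(* The first level whose cells, of side [u l], are more than D times as wide as the box of the
   object. *)
pose lev i := ex_minn (levex i).
have lev_lt i : r i < u (lev i) / D%:R by rewrite /lev; case: ex_minnP.
have lev_min i l : r i < u l / D%:R -> (lev i <= l)%N.
  by rewrite /lev; case: ex_minnP => m _; apply.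
have lev_small i : ~~ big i -> lev i = 0.
  move=> /rsmall ri; apply/eqP; rewrite -leqn0; apply: lev_min.
  by rewrite /u expr0 mulr1.
have lev_big i : big i -> (0 < lev i)%N.
  move=> bi; rewrite lt0n; apply/eqP => l0; have := lev_lt i.
  have /andP[er _] := rbig _ bi; rewrite l0 /u expr0 mulr1 => /(le_lt_trans er).
  by rewrite ltr_pdivlMr // gtr_pMr // ltrn1.
have big_lev i : (0 < lev i)%N -> big i.
  by apply: contraTT => /lev_small->.
(* By minimality of [lev], the box is not small for level l - 1; the loss is D there, D+1 between
   the levels, and 2 from the box. *)
have side_ge i l : (0 < l <= lev i)%N -> u l / (2 * D * D.+1)%:R <= sidelen (O i).
  case: l => // l /= li.
  have bi : big i by apply: big_lev; apply: leq_ltn_trans li.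
  have ri : u l / D%:R <= r i by rewrite leNgt; apply/negP => /lev_min; rewrite leqNgt li.
  have /andP[_ r2] := rbig _ bi.
  rewrite uS ler_pdivrMr ?ltr0n // !natrM mulrA ler_pM2r ?ltr0n //.
  by rewrite mulrA (mulrC (sidelen _)) -ler_pdivrMr //; apply: le_trans r2.
pose ky (s : 'I_D) l (x : pt R d) : {ffun 'I_d -> int} :=
  [ffun t => Num.floor (x t / u l - s%:R / D%:R)].
have kyS s l m x y : (l <= m)%N -> ky s l x = ky s l y -> ky s m x = ky s m y.
  move=> /subnKC <-; elim: (m - l)%N => [|k IH] xy; first by rewrite addn0.
  apply/ffunP => t; move/ffunP/(_ t): (IH xy); rewrite !ffunE addnS uS.
  exact: floor_coarsen.
(* The objects that lie inside a single cell of their own level for shift [s]. *)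
pose al s i := `[< forall x, O i x -> ky s (lev i) x = ky s (lev i) (a i) >].
exists al; split.
  move=> i j; apply/existsP; apply: contraT; rewrite negb_exists => /forallP bad.
  have step k x t : O k x -> let y := a k t / u (lev k) in
      y <= x t / u (lev k) < y + D%:R^-1.
    move=> /(Or k)/(_ t)/andP[ax xa] /=; rewrite ler_pM2r ?invr_gt0 // ax /=.
    rewrite -ltrBlDl -mulrBl ltr_pdivrMr // (mulrC _ (u _)).
    by apply: le_lt_trans (lev_lt k); lra.
  (* If every shift failed for i or j, recording the object and the coordinate cut would inject 2d+1
     shifts into 2d pairs. *)
  have [F HF] : {F : 'I_D -> 'I_d * bool & forall s, let k := if (F s).2 then i else j in
      exists2 x, O k x & ky s (lev k) x (F s).1 != ky s (lev k) (a k) (F s).1}.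
    apply: (@choice _ _ (fun s (F : 'I_d * bool) => let k := if F.2 then i else j in
      exists2 x, O k x & ky s (lev k) x F.1 != ky s (lev k) (a k) F.1)) => s.
    have one k : ~~ al s k -> exists t, exists2 x, O k x &
        ky s (lev k) x t != ky s (lev k) (a k) t.
      move=> /asboolPn/existsNP[x /not_implyP[Ox ne]].
      have : ~ forall t, ky s (lev k) x t = ky s (lev k) (a k) t by move/ffunP.
      by move=> /existsNP[t /eqP H]; exists t, x.
    have := bad s; rewrite negb_and => /orP[/one[t Ht]|/one[t Ht]].
      by exists (t, true).
    by exists (t, false).
  have /leq_card : injective F.
    move=> s s' Fs; have [x Ox] := HF s; have [x' Ox'] := HF s'.
    rewrite -Fs in Ox' *; rewrite !ffunE => ne' ne; apply: val_inj.
    apply: (floor_shift_inj _ _ (step _ _ _ Ox) (step _ _ _ Ox') ne ne') => //.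
  by rewrite card_prod card_ord card_bool card_ord mulnC ltnn.
move=> s.
have alP i x l : al s i -> O i x -> (lev i <= l)%N -> ky s l x = ky s l (a i).
  by move=> /asboolP H Ox li; apply: (kyS s (lev i)) => //; apply: H.
have adj_ky l i j : al s i -> al s j -> (lev i <= l)%N -> (lev j <= l)%N ->
    fadj i j -> ky s l (a i) = ky s l (a j).
  move=> ai aj li lj; rewrite /fadj => /andP[/asboolP[x [Oi Oj]] _].
  by rewrite -(alP i x) // (alP j x).
have adj_lev0 i j : lev i = 0 -> lev j = 0 -> ~~ fadj i j.
  move=> i0 j0; rewrite /fadj; apply/negP => /andP[_].
  by case/orP=> /lev_big; rewrite ?i0 ?j0.
apply: (@forest_exists _ _ fadj (fun l i => ky s l (a i)) lev (al s) _ adj_ky adj_lev0 _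
  (\max_i lev i) (enum (al s)) [::]).
(* The cell is cut into M^d subcubes of side [w], small enough by [side_ge] for fatness to pierce
   all objects of level at least [l] that meet one of them. *)
- move=> l k A B l0 HA HB; set M := (2 * D * D.+1)%N.
  have M0 : 0 < M%:R :> R by rewrite ltr0n.
  pose w := u l / M%:R; have w0 : 0 < w by rewrite divr_gt0.
  pose corner (m : {ffun 'I_d -> 'I_M}) : pt R d :=
    fun t => u l * ((k t)%:~R + s%:R / D%:R) + (m t)%:R * w.
  have [P HP] : {P : {ffun 'I_d -> 'I_M} -> 'I_c -> pt R d & forall m i,
      O i `&` cube (corner m) w !=set0 -> w <= sidelen (O i) -> exists j, O i (P m j)}.
    by apply: (@choice _ _ (fun m (P : 'I_c -> pt R d) => forall i,
      O i `&` cube (corner m) w !=set0 -> w <= sidelen (O i) -> exists j, O i (P j))) => m;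
      apply: fO.
  exists [seq [seq i <- enum 'I_n | big i && `[< O i (P m j) >]] |
    m <- enum {ffun 'I_d -> 'I_M}, j <- enum 'I_c]; split.
  + by rewrite size_allpairs -!cardE card_ord.
  + apply/allP => _ /allpairsP[[m j] [_ _ ->]]; apply/cliqueP => i i'.
    rewrite !mem_filter => /andP[/andP[bi /asboolP Oi] _] /andP[/andP[bi' /asboolP Oi'] _].
    by rewrite /fadj bi andbT; apply/asboolP; exists (P m j).
  + move=> g h i j /mapP[i' iB ->] /mapP[j' jA ->]; rewrite !inE => /eqP-> /eqP-> {g h i j}.
    move: i' iB j' jA => i iB j jA ij.
    have /and3P[ai li /eqP kE] := HB _ iB; have /andP[aj lj] := HA _ jA.
    have bj : big j by apply: big_lev; apply: leq_trans lj.
    have [x [Oi Oj]] : O i `&` O j !=set0 by case/andP: ij => /asboolP.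
    have kx : ky s l x = k by rewrite (alP i).
    (* The position of the common point x in its cell, scaled to [0,1); truncating M z gives the
       subcube. *)
    pose z t := x t / u l - s%:R / D%:R - (k t)%:~R.
    have zP t : 0 <= z t < 1.
      have := floor_itv (x t / u l - s%:R / D%:R).
      have -> : Num.floor (x t / u l - s%:R / D%:R) = k t by rewrite -kx ffunE.
      by rewrite rmorphD rmorph1 /= /z subr_ge0 => /andP[k1 k2]; rewrite k1 ltrBlDl.
    have mP t : (Num.truncn (z t * M%:R) < M)%N.
      have /andP[z0 z1] := zP t.
      rewrite -(ltr_nat R); apply: le_lt_trans (_ : z t * M%:R < _).
        by rewrite truncn_le // mulr_ge0 // ltW.
      by rewrite gtr_pMl.
    pose m := [ffun t => Ordinal (mP t)].
    have [||jj Ojj] := HP m j.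
    * exists x; split=> // t; rewrite /corner ffunE /=.
      have /andP[z0 z1] := zP t.
      have zM : 0 <= z t * M%:R by rewrite mulr_ge0 // ltW.
      have /andP[t1 t2] := truncn_itv zM.
      set q := Num.truncn _ in t1 t2 *.
      have xE : x t = u l * ((k t)%:~R + s%:R / D%:R) + (z t * M%:R) * w.
        rewrite /w /z; have := u0 l; have := M0; have := D0.
        move: (D%:R) (M%:R) (u l) => D' M' u' D'0 M'0 u'0.
        by field; rewrite !gt_eqF.
      have q1 : q%:R * w <= z t * M%:R * w by rewrite ler_pM2r.
      have q2 : z t * M%:R * w <= q%:R * w + w.
        by rewrite -[X in _ + X]mul1r -mulrDl ler_pM2r // natr1 ltW.
      rewrite xE lerD2l q1 -addrA lerD2l; exact: q2.
    * by apply: side_ge; rewrite l0 lj.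
    exists [seq i <- enum 'I_n | big i && `[< O i (P m jj) >]].
      by apply: allpairs_f; rewrite mem_enum.
    by rewrite mem_filter bj mem_enum !andbT; apply/asboolP.
- by move=> i; rewrite mem_enum => ai; rewrite [al s i]ai /=; apply: leq_bigmax.
- by [].
- by left.
Qed.

End FatForest.

(** * From nets to hop spanners of the intersection graph *)

Lemma hop_spanner_of_conn (R : realType) (n : nat) (E : 'I_n -> 'I_n -> Prop)
    (H : seq ('I_n * 'I_n)) (f : nat) (t : R) : f%:R <= t ->
  (forall i j, (i, j) \in H -> i != j -> E i j) ->
  (forall i j, E i j -> conn H f i j) ->
  exists2 S : {set {set 'I_n}}, is_hop_spanner E S t & (#|S| <= size H)%N.
Proof.
move=> ft HE EH.
pose F (e : 'I_n * 'I_n) := finset.setU (finset.set1 e.1) (finset.set1 e.2).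
(* Loops are discarded here; walks may rest instead of using them. *)
pose s := [seq F e | e <- H & e.1 != e.2].
exists (finset.finset (mem s)); last first.
  rewrite cardsE; apply: leq_trans (card_size _) _.
  by rewrite size_map size_filter count_size.
have FS i j : i != j -> (i, j) \in H -> F (i, j) \in finset.finset (mem s).
  by move=> ij ijH; rewrite inE; apply: map_f; rewrite mem_filter ij.
split.
  move=> e; rewrite inE => /mapP[[i j]]; rewrite mem_filter => /andP[/= ij ijH] ->.
  by exists i, j; split=> //; apply: HE.
move=> i j /EH; pose path_rel := fun x y : 'I_n => F (x, y) \in finset.finset (mem s).
suff H0 m u v : conn H m u v -> exists p, path path_rel u p /\ last u p = v /\ (size p <= m)%N.
  move=> /H0[p [pp [lp sp]]]; exists p; split=> //; split=> //.
  by apply: le_trans ft; rewrite ler_nat.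
elim: m u => [u /= <-|m IH u [w + /IH[p [pp [lp sp]]]]]; first by exists [::].
have [-> _|uw /= uwH] := eqVneq u w.
  by exists p; split=> //; split=> //; apply: leqW.
exists (w :: p); split=> //=; rewrite pp andbT /path_rel.
case/orP: uwH => uwH; first exact: (FS u w).
have -> : F (u, w) = F (w, u) by rewrite /F finset.setUC.
by apply: (FS w u); rewrite 1?eq_sym.
Qed.

(** Equality holds for [k = 0], where both sides are 3; afterwards the right side grows faster. *)
Lemma hops_le (R : realType) k : (3 + 5 * k)%:R <= 11 / 9 * 3 ^+ k.+1 - 2 / 3 :> R.
Proof.
suff : (9 * (3 + 5 * k) + 6 <= 11 * 3 ^ k.+1)%N.
  rewrite -(ler_nat R) natrD !natrM natrX => H; lra.
by elim: k => // k; rewrite (expnS _ k.+1); lia.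
Qed.

(* Point-like objects that meet coincide, so a star on each class of coinciding
   ones takes care of the edges ignored by [fadj]. *)
Lemma point_stars (R : realType) (d n : nat) (O : 'I_n -> set (pt R d)) :
  (forall i, bounded_obj (O i)) ->
  exists Z : seq ('I_n * 'I_n), [/\ size Z = n,
    forall i j, (i, j) \in Z -> i != j -> O i `&` O j !=set0 &
    forall i j, ~~ big O i -> ~~ big O j -> O i `&` O j !=set0 -> conn Z 2 i j].
Proof.
move=> bO.
pose nbr i := [seq j <- enum 'I_n | ~~ big O j && `[< O i `&` O j !=set0 >]].
exists [seq (i, head i (nbr i)) | i <- enum 'I_n]; split.
- by rewrite size_map -cardE card_ord.
- move=> i j /mapP[i' _ [-> ->]].
  case E : (nbr i') => [|j' s] /=; first by rewrite eqxx.
  have : j' \in nbr i' by rewrite E mem_head.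
  by rewrite mem_filter => /andP[/andP[_ /asboolP]].
- move=> i j si sj [x [Oi Oj]].
  have pts k : ~~ big O k -> O k x -> forall y, O k y -> y = x.
    by rewrite /big -leNgt => sk Okx y Oky; apply: sidelen_le0_subset1 (bO k) sk Oky Okx.
  have E : nbr i = nbr j.
    apply: eq_filter => k; congr andb; apply/asboolP/asboolP => -[y [Oy Oky]].
      by exists x; split=> //; rewrite -(pts i si Oi y).
    by exists x; split=> //; rewrite -(pts j sj Oj y).
  have jnbr : j \in nbr j.
    by rewrite mem_filter sj mem_enum andbT; apply/asboolP; exists x.
  have edge k : (k, head k (nbr k)) \in [seq (i, head i (nbr i)) | i <- enum 'I_n].
    by apply: (map_f (fun i => (i, head i (nbr i)))); rewrite mem_enum.
  apply: (@conn_trans _ _ 1 1 _ (head i (nbr i))); first exact: conn1 (edge i).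
  have -> : head i (nbr i) = head j (nbr j).
    by rewrite E; case: (nbr j) jnbr.
  exact: conn1C (edge j).
Qed.

Theorem theorem15 (R : realType) (d c : nat) :
  (1 <= d)%N -> (1 <= c)%N ->
  forall k : nat, (1 <= k)%N ->
  exists C : R, exists N : nat, forall n : nat, (N <= n)%N ->
    forall O : 'I_n -> set (pt R d),
      (forall i, bounded_obj (O i)) -> fat c O ->
      exists H : {set {set 'I_n}},
        is_hop_spanner (igraph_edge O) H (11 / 9 * 3 ^+ k - 2 / 3 : R) /\
        (#|H|%:R <= C * n%:R * alpha k n%:R).
Proof.
move=> _ _ [//|k] _; set D := (2 * d).+1.
have [B HB] := @solvable_exists R k (#|{ffun 'I_d -> 'I_(2 * D * D.+1)}| * c)%N.
(* [B] for each of the D shifts, and 1 for the n star edges on point-like objects; from n = 2 on,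
   [alpha] is at least 1 and absorbs these. *)
exists (B * D).+1%:R, 2%N => n n2 O bO fO.
have [a aE /andP[a0 _]] := @alphaS_nat R k n n2.
have [al [alP forest]] := fat_forest bO fO.
have [Z [szZ ZO Zconn]] := point_stars bO.
have [||X [vX cX SX]] := @gather_seq _ (fadj O) _ (enum 'I_D) (B * n * a)
  (fun s X => forall i j, al s i -> al s j -> i != j -> fadj O i j ->
     conn X.1 (3 + 5 * k) i j).
- by move=> s X Y [sub _] SX i j ai aj ij /(SX i j ai aj ij); apply: conn_sub.
- move=> s _; have [t [pt gt]] := forest s.
  have [X [vX cX sX]] := HB _ _ _ (fadjC O) gt.
  exists X; split=> //.
    have szt : (size (labels t) <= n)%N.
      by rewrite (perm_size pt) size_map -cardE -[leqRHS](card_ord n) max_card.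
    rewrite -(ler_nat R); apply: le_trans cX _.
    rewrite [leRHS]natrM -aE; apply: ler_pM; rewrite ?ler0n ?ler_nat ?leq_mul2l ?szt ?orbT //.
      by have [m [-> _ _]] := alphaSP k ((size (labels t))%:R : R).
    by apply: (@alpha_mono R k.+1); rewrite ler_nat.
  move=> i j ai aj ij ij_adj.
  have lab v : al s v -> [:: v] \in labels t.
    by move=> av; rewrite (perm_mem pt) map_f // mem_enum.
  (* All labels are singletons, so the ports can only be i and j themselves. *)
  have [||i' [j' [ii' jj' ij']]] := sX [:: i] [:: j] (lab _ ai) (lab _ aj).
  + by apply: contraNneq ij => -[->].
  + by apply/linkedP; exists i, j; rewrite !mem_head.
  have /andP[_ /allP portP] := vX.
  move: (portP _ ii') (portP _ jj') ij'; rewrite /= !inE.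
  by move=> /eqP-> /eqP->.
have [||S SE cS] := @hop_spanner_of_conn R n (igraph_edge O) (X.1 ++ Z) (3 + 5 * k) _
    (hops_le R k).
- move=> i j; rewrite mem_cat => /orP[ijX|ijZ] ij; split=> //; last exact: ZO ijZ ij.
  have /andP[/allP/(_ _ ijX)/= + _] := vX.
  by rewrite /fadj => /andP[/asboolP].
- move=> i j [ij Oij]; have [bij|] := boolP (big O i || big O j).
    have [s /andP[ai aj]] := alP i j.
    apply: (@conn_sub _ X.1); first by move=> e; rewrite mem_cat => ->.
    apply: (SX s) => //; first by rewrite mem_enum.
    by rewrite /fadj bij andbT; apply/asboolP.
  rewrite negb_or => /andP[si sj].
  apply: (@conn_sub _ Z); first by move=> e; rewrite mem_cat orbC => ->.
  by apply: conn_le (Zconn i j si sj Oij); rewrite ltnW // leq_addr.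
exists S; split=> //; rewrite aE -!natrM ler_nat; apply: leq_trans cS _.
rewrite size_cat szZ; have : (size X.1 <= B * n * a * D)%N.
  by apply: leq_trans (leq_addr _ _) _; apply: leq_trans cX _; rewrite -cardE card_ord.
have : (n <= n * a)%N by rewrite leq_pmulr.
have -> : ((B * D).+1 * n * a = B * n * a * D + n * a)%N by rewrite -addn1; ring.
by move=> na Xa; apply: leq_add.
Qed.
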